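(* Let $M$ be a 4-dimensional connected, orientable smooth manifold, $a$ a Lorentzian metric on $M$ of signature $(+,-,-,-)$ and $b$ a 1-form on $M$; put $A=a_{ij}\dot x^i\dot x^j$, $B=b_i\dot x^i$, $s=B^2/A$. A Bogoslovsky-Kropina metric $L=A\,s^{q}=A^{1-q}B^{2q}$, with $q\in\mathbb{R}$, $q\neq0$, defines a Finsler spacetime structure if and only if one of the following happens: (i) $\langle b,b\rangle\ge0$ and $q\in[-1,1)$. In this case, the future-pointing timelike cones of $L$ coincide with those of $a$. (ii) $\langle b,b\rangle<0$ and $q\in(0,1)$. In this case, the future-pointing timelike cones of $L$ are obtained by intersecting the future-pointing timelike cones of $a$ with the half-space $B>0$.
   Context: $\overset{\circ}{TM}=TM\setminus\{0\}$. A conic subbundle of $TM$ is a non-empty open submanifold $\mathcal{Q}\subset\overset{\circ}{TM}$ projecting onto all of $M$ and closed under $(x,\dot x)\mapsto(x,\lambda\dot x)$, $\lambda>0$. A pseudo-Finsler structure is a smooth function $L:\mathcal{A}\to\mathbb{R}$ on a conic subbundle $\mathcal{A}$ with $L(x,\lambda\dot x)=\lambda^2L(x,\dot x)$ for $\lambda>0$ and $g_{ij}=\frac12\frac{\partial^2L}{\partial\dot x^i\partial\dot x^j}$ nondegenerate on $\mathcal{A}$; $\mathcal{A}$ is the maximal subset of $\overset{\circ}{TM}$ with these properties. An $(\alpha,\beta)$-metric is by definition a pseudo-Finsler structure of the form $L=A\Psi(s)$ with $\Psi$ smooth on $s(\mathcal{A})$. ''A Bogoslovsky-Kropina metric'' is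 an $(\alpha,\beta)$-metric with $\Psi(s)=s^q$; in particular $\mathcal{A}$, the set where $L$ is defined and smooth with nondegenerate $g$, is assumed to be a conic subbundle (so it has points over every $x\in M$). Real powers are taken of positive bases, so $A>0$, $B\ne0$ on $\mathcal{A}$, and $B^{2q}$ means $(B^2)^q$. $\langle b,b\rangle=a^{ij}b_ib_j$. The conditions $\langle b,b\rangle\ge0$, resp. $\langle b,b\rangle<0$, are understood to hold on all of $M$, and the 1-form $b$ is understood to satisfy one of these two (either non-spacelike everywhere, or spacelike everywhere). $L$ defines a Finsler spacetime structure if there exists a connected conic subbundle $\mathcal{T}\subset\mathcal{A}$ with connected fibers $\mathcal{T}_x=\mathcal{T}\cap T_xM$ such that on each $\mathcal{T}_x$: $L>0$, $g$ has signature $(+,-,-,-)$, and $L$ can be continuously extended as $0$ to the boundary $\partial\mathcal{T}_x$ (in $T_xM$). The $\mathcal{T}_x$ are the future-pointing timelike cones of $L$. Since $L$ depends only on $B^2$, in (ii) the sign of $B$ on $\mathcal{T}_x$ is a choice, and $B>0$ is chosen. Standing assumption: at each $x$, $\mathcal{T}_x$ and the future-pointing timelike cone $\mathcal{T}^a_x$ of $a$ (one of the two connected components of $\{\dot x\in T_xM:A>0\}$, according to a time orientation of $a$) have non-empty intersection. *)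

(* Defs.v *)
From HB Require Import structures.
From mathcomp Require Import all_boot all_order all_algebra.
From mathcomp Require Import all_classical all_reals all_analysis.

Set Implicit Arguments.
Unset Strict Implicit.
Unset Printing Implicit Defensive.

Import Order.TTheory GRing.Theory Num.Theory.
Import numFieldNormedType.Exports.

Local Open Scope classical_set_scope.
Local Open Scope ring_scope.

(* C^k at the points of [U], which is an open set in the main uses;
   in finite dimension "all directional derivatives are C^k" says that
   the derivative is C^k. *)
Fixpoint Ck (R : realType) (V W : normedModType R) (k : nat) (U : set V)
    (f : V -> W) : Prop :=
  if k is k'.+1 then
    (forall x, U x -> differentiable f x) /\
    (forall v : V, Ck k' U (fun x => 'D_v f x))
  else forall x, U x -> {for x, continuous f}.

Definition smooth_on (R : realType) (V W : normedModType R) (U : set V)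
    (f : V -> W) : Prop :=
  forall k, Ck k U f.

Record chart (R : realType) (n : nat) (M : topologicalType) := Chart {
  chart_dom : set M;
  chart_map :> M -> 'rV[R]_n;
  chart_inv : 'rV[R]_n -> M;
  chart_dom_open : open chart_dom;
  chart_img_open : open (chart_map @` chart_dom);
  chart_mapK : forall x, chart_dom x -> chart_inv (chart_map x) = x;
  chart_map_continuous : forall x, chart_dom x -> {for x, continuous chart_map};
  chart_inv_continuous :
    forall p, (chart_map @` chart_dom) p -> {for p, continuous chart_inv} }.

Definition chart_img (R : realType) (n : nat) (M : topologicalType)
    (c : chart R n M) : set 'rV[R]_n :=
  c @` chart_dom c.

Definition overlap (R : realType) (n : nat) (M : topologicalType)
    (c c' : chart R n M) : set 'rV[R]_n :=
  c @` (chart_dom c `&` chart_dom c').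

Definition transition (R : realType) (n : nat) (M : topologicalType)
    (c c' : chart R n M) : 'rV[R]_n -> 'rV[R]_n :=
  c' \o chart_inv c.

(* The atlas need not be maximal; [chart_at x] is a preferred chart at [x],
   used below only to coordinatize the tangent space at [x]. *)
Record manifold (R : realType) (n : nat) := Manifold {
  carrier :> topologicalType;
  manifold_hausdorff : hausdorff_space carrier;
  manifold_second_countable : @second_countable carrier;
  atlas : set (chart R n carrier);
  chart_at : carrier -> chart R n carrier;
  chart_at_atlas : forall x, atlas (chart_at x);
  chart_at_dom : forall x, chart_dom (chart_at x) x;
  transition_smooth : forall c c', atlas c -> atlas c' ->
    smooth_on (overlap c c') (transition c c') }.

Definition compatible_chart (R : realType) (n : nat) (M : manifold R n)
    (c : chart R n M) : Prop :=
  forall c', atlas c' ->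
    smooth_on (overlap c c') (transition c c') /\
    smooth_on (overlap c' c) (transition c' c).

Definition orientable (R : realType) (n : nat) (M : manifold R n) : Prop :=
  exists S : set (chart R n M),
    [/\ forall c, S c -> compatible_chart c,
        forall x, exists2 c, S c & chart_dom c x
      & forall c c', S c -> S c' -> forall p, overlap c c' p ->
          0 < \det (jacobian (transition c c') p)].

(* A tangent vector at [x] is given by its coordinates in the chart
   [chart_at x]. A record rather than a product, because the topology of the
   tangent bundle is not the product one. *)
Record tangent_bundle (R : realType) (n : nat) (M : manifold R n) :=
  Tangent { base : M; vec : 'rV[R]_n }.

(* The i-th row consists of the coordinates, in the tangent space at
   [chart_inv c p], of the i-th coordinate vector field of [c]. *)
Definition chart_frame (R : realType) (n : nat) (M : manifold R n)
    (c : chart R n M) (p : 'rV[R]_n) : 'M[R]_n :=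
  jacobian (transition c (chart_at (chart_inv c p))) p.

(* Inverse of the chart of the tangent bundle induced by [c]. *)
Definition tangent_param (R : realType) (n : nat) (M : manifold R n)
    (c : chart R n M) (pu : 'rV[R]_n * 'rV[R]_n) : tangent_bundle M :=
  Tangent (chart_inv c pu.1) (pu.2 *m chart_frame c pu.1).

Definition in_chart (R : realType) (n : nat) (M : manifold R n)
    (c : chart R n M) (W : set (tangent_bundle M))
    : set ('rV[R]_n * 'rV[R]_n) :=
  [set pu | chart_img c pu.1 /\ W (tangent_param c pu)].

Definition tangent_open (R : realType) (n : nat) (M : manifold R n)
    : set_system (tangent_bundle M) :=
  [set W | forall c, atlas c -> open (in_chart c W)].

Lemma tangent_openT (R : realType) (n : nat) (M : manifold R n) :
  tangent_open [set: tangent_bundle M].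
Proof.
move=> c _; rewrite (_ : in_chart c setT = fst @^-1` chart_img c); last first.
  by apply/seteqP; split => pu //= [].
by apply: open_comp; [move=> pu _; exact: cvg_fst|exact: chart_img_open].
Qed.

Lemma tangent_openI (R : realType) (n : nat) (M : manifold R n) :
  setI_closed (@tangent_open R n M).
Proof.
move=> W W' oW oW' c ac.
rewrite (_ : in_chart c _ = in_chart c W `&` in_chart c W').
  by apply: openI; [exact: oW|exact: oW'].
by apply/seteqP; split => pu /= [] => [? []|[? ?] []].
Qed.

Lemma tangent_open_bigU (R : realType) (n : nat) (M : manifold R n)
    (I : Type) (W : I -> set (tangent_bundle M)) :
  (forall i, tangent_open (W i)) -> tangent_open (\bigcup_i W i).
Proof.
move=> oW c ac.
rewrite (_ : in_chart c _ = \bigcup_i in_chart c (W i)).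
  by apply: bigcup_open => i _; exact: oW.
apply/seteqP; split => pu /=; first by move=> [? [i ? ?]]; exists i.
by move=> [i _ [? ?]]; split => //; exists i.
Qed.

HB.instance Definition _ (R : realType) (n : nat) (M : manifold R n) :=
  gen_eqMixin (tangent_bundle M).
HB.instance Definition _ (R : realType) (n : nat) (M : manifold R n) :=
  gen_choiceMixin (tangent_bundle M).
HB.instance Definition _ (R : realType) (n : nat) (M : manifold R n) :=
  isOpenTopological.Build (tangent_bundle M)
    (@tangent_openT R n M) (@tangent_openI R n M) (@tangent_open_bigU R n M).

Definition tangent_smooth_on (R : realType) (n : nat) (M : manifold R n)
    (W : set (tangent_bundle M)) (L : tangent_bundle M -> R) : Prop :=
  forall c, atlas c -> smooth_on (in_chart c W) (L \o @tangent_param R n M c).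

Definition fiber (R : realType) (n : nat) (M : manifold R n)
    (W : set (tangent_bundle M)) (x : M) : set 'rV[R]_n :=
  [set v | W (Tangent x v)].

(* Bilinear forms and covectors at [x] are given by their components in the
   chart [chart_at x]; the maps below are their components in a chart [c]. *)
Definition smooth_bilinear_field (R : realType) (n : nat) (M : manifold R n)
    (a : M -> 'M[R]_n) : Prop :=
  forall c : chart R n M, atlas c -> smooth_on (chart_img c)
    (fun p => chart_frame c p *m a (chart_inv c p) *m (chart_frame c p)^T).

Definition one_form (R : realType) (n : nat) (M : manifold R n)
    (b : M -> 'rV[R]_n) : Prop :=
  forall c : chart R n M, atlas c -> smooth_on (chart_img c)
    (fun p => b (chart_inv c p) *m (chart_frame c p)^T).

(* Signature (+,-,...,-). *)
Definition lorentzian_form (R : realType) (n : nat) (G : 'M[R]_n) : Prop :=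
  exists2 P : 'M[R]_n, P \in unitmx &
    P *m G *m P^T =
      diag_mx (\row_(j < n) (if (j == 0 :> nat)%N then 1 else -1)).

Definition lorentzian_metric (R : realType) (n : nat) (M : manifold R n)
    (a : M -> 'M[R]_n) : Prop :=
  [/\ smooth_bilinear_field a, forall x, (a x)^T = a x
    & forall x, lorentzian_form (a x)].

Definition quad (R : realType) (n : nat) (M : manifold R n)
    (a : M -> 'M[R]_n) (w : tangent_bundle M) : R :=
  (vec w *m a (base w) *m (vec w)^T) 0 0.

Definition lin (R : realType) (n : nat) (M : manifold R n)
    (b : M -> 'rV[R]_n) (w : tangent_bundle M) : R :=
  (vec w *m (b (base w))^T) 0 0.

Definition sq_norm (R : realType) (n : nat) (M : manifold R n)
    (a : M -> 'M[R]_n) (b : M -> 'rV[R]_n) (x : M) : R :=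
  (b x *m invmx (a x) *m (b x)^T) 0 0.

(* A continuous choice (openness in the tangent bundle), over every point, of
   one of the connected components of the set of timelike vectors. *)
Definition time_orientation (R : realType) (n : nat) (M : manifold R n)
    (a : M -> 'M[R]_n) (Ta : set (tangent_bundle M)) : Prop :=
  open Ta /\
  forall x, exists2 v, 0 < quad a (Tangent x v) &
    fiber Ta x = connected_component [set u | 0 < quad a (Tangent x u)] v.

Definition conic_subbundle (R : realType) (n : nat) (M : manifold R n)
    (Q : set (tangent_bundle M)) : Prop :=
  [/\ Q !=set0, open Q, forall w, Q w -> vec w != 0,
      forall x, fiber Q x !=set0
    & forall x v (l : R), 0 < l -> Q (Tangent x v) -> Q (Tangent x (l *: v))].

Definition fundamental_tensor (R : realType) (n : nat) (M : manifold R n)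
    (L : tangent_bundle M -> R) (w : tangent_bundle M) : 'M[R]_n :=
  \matrix_(i, j) (2^-1 *
    'D_(delta_mx 0 i)
      (fun u : 'rV[R]_n =>
         'D_(delta_mx 0 j) (fun u' : 'rV[R]_n => L (Tangent (base w) u')) u)
      (vec w)).

(* [D] is the set where the expression [L] makes sense: as functions are
   total, maximality of the conic subbundle has to be relative to it. *)
Definition pseudo_finsler_on (R : realType) (n : nat) (M : manifold R n)
    (D : set (tangent_bundle M)) (L : tangent_bundle M -> R)
    (Q : set (tangent_bundle M)) : Prop :=
  [/\ conic_subbundle Q /\ Q `<=` D,
      tangent_smooth_on Q L,
      forall x v (l : R), 0 < l -> Q (Tangent x v) ->
        L (Tangent x (l *: v)) = l ^+ 2 * L (Tangent x v)
    & forall w, Q w -> fundamental_tensor L w \in unitmx].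

Definition pseudo_finsler (R : realType) (n : nat) (M : manifold R n)
    (D : set (tangent_bundle M)) (L : tangent_bundle M -> R)
    (Q : set (tangent_bundle M)) : Prop :=
  pseudo_finsler_on D L Q /\
  forall Q', pseudo_finsler_on D L Q' -> Q' `<=` Q.

Definition ab_ratio (R : realType) (n : nat) (M : manifold R n)
    (a : M -> 'M[R]_n) (b : M -> 'rV[R]_n) (w : tangent_bundle M) : R :=
  lin b w ^+ 2 / quad a w.

Definition ab_function (R : realType) (n : nat) (M : manifold R n)
    (a : M -> 'M[R]_n) (b : M -> 'rV[R]_n) (Psi : R -> R)
    (w : tangent_bundle M) : R :=
  quad a w * Psi (ab_ratio a b w).

(* [I] is the domain of [Psi]. *)
Definition alpha_beta_metric (R : realType) (n : nat) (M : manifold R n)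
    (a : M -> 'M[R]_n) (b : M -> 'rV[R]_n) (I : set R) (Psi : R -> R)
    (Q : set (tangent_bundle M)) : Prop :=
  pseudo_finsler [set w | quad a w != 0 /\ I (ab_ratio a b w)]
    (ab_function a b Psi) Q /\
  smooth_on (ab_ratio a b @` Q) Psi.

Definition bk_function (R : realType) (n : nat) (M : manifold R n)
    (a : M -> 'M[R]_n) (b : M -> 'rV[R]_n) (q : R) :
    tangent_bundle M -> R :=
  ab_function a b (fun s => s `^ q).

(* The base [s] of the power is positive exactly where [quad a] is positive
   and [lin b] does not vanish. *)
Definition bogoslovsky_kropina (R : realType) (n : nat) (M : manifold R n)
    (a : M -> 'M[R]_n) (b : M -> 'rV[R]_n) (q : R)
    (Q : set (tangent_bundle M)) : Prop :=
  alpha_beta_metric a b [set s | 0 < s] (fun s => s `^ q) Q.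

Definition extends_by_0 (R : realType) (n : nat) (C : set 'rV[R]_n)
    (f : 'rV[R]_n -> R) : Prop :=
  exists h : 'rV[R]_n -> R,
    [/\ {within closure C, continuous h},
        forall v, C v -> h v = f v
      & forall v, (closure C `\` interior C) v -> h v = 0].

(* [T] consists of future-pointing timelike cones of [L] compatible with the
   time orientation [Ta]. *)
Definition timelike_cones (R : realType) (n : nat) (M : manifold R n)
    (L : tangent_bundle M -> R) (Q Ta T : set (tangent_bundle M)) : Prop :=
  [/\ conic_subbundle T /\ connected T,
      T `<=` Q,
      forall x, [/\ connected (fiber T x),
        forall v, fiber T x v -> 0 < L (Tangent x v),
        forall v, fiber T x v -> lorentzian_form
          (fundamental_tensor L (Tangent x v))
      & extends_by_0 (fiber T x) (fun v => L (Tangent x v))]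
    & forall x, fiber T x `&` fiber Ta x !=set0].

Definition finsler_spacetime (R : realType) (n : nat) (M : manifold R n)
    (L : tangent_bundle M -> R) (Q Ta : set (tangent_bundle M)) : Prop :=
  exists T, timelike_cones L Q Ta T.

(* Main.v *)
Require Import Defs.
From mathcomp Require Import all_boot all_order all_algebra.
From mathcomp Require Import all_classical all_reals all_analysis.
From mathcomp Require Import ring lra.

Set Implicit Arguments.
Unset Strict Implicit.
Unset Printing Implicit Defensive.

Import Order.TTheory GRing.Theory Num.Theory.
Import numFieldNormedType.Exports.
Local Open Scope classical_set_scope.
Local Open Scope ring_scope.

(* At a vector [v] with [A > 0] and [B != 0] put [t = a(v, .) / A],
   [s = b / B - t] and [h = t^2 - a / A], which is positive definite on the
   [a]-orthogonal complement of [v]. Then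
     g = L ((t + q s)^2 - (1 - q) (h + q s^2)),
   so [g] is Lorentzian iff [q < 1] and [(1 + q) B^2 - q <b, b> A > 0].
   As [L] is continuous and positive where [A > 0] and [B != 0], its extension
   by [0] leaves no room for boundary points of [T_x] there: whatever [q] is,
   [T_x] is the whole timelike cone of [a] when [<b, b> >= 0] (then [B] does not
   vanish on it) and one of its halves when [<b, b> < 0]. The Lorentzian
   condition has then to hold on the whole cone: approaching the light cone it
   gives [q >= -1], approaching the hyperplane [B = 0] it gives [q > 0].
   Conversely, maximality of the domain of [L] puts the cone inside it, and [L]
   tends to [0] at the boundary; for [q < 0] this uses
   [A |b(t)| <= 2 a(v, t) |B|] for causal [b] and [v], [t] in the same cone. *)

(** * Functions of class C^k *)

(** Two degenerate configurations shape case (i): a zero of [b] and, for [q = -1], a null [b]. Both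
    are excluded because the domain of [L] has a point over every [x]. At such a point [B] does not
    vanish, and if [q = -1] and [<b, b> = 0], then [g] would have a kernel there. The same endpoint
    needs its own boundary estimate. For [-1 < q < 0] the majorant of [L] is a multiple of
    [A^(1 + q) a(t, .)^(-2 q)], and at [q = -1] it is no longer forced to vanish on the light cone.
    There the reverse Cauchy-Schwarz inequality gives [L = A^2 / B^2 <= A / <b, b>] instead. Two
    global facts supplement the pointwise analysis: [L] is smooth in the induced charts of the
    tangent bundle, where the components of [a] and [b] vary with the base point, and the union of
    the cones is connected, since [M] and the fibers are and the projection is open. *)

Section CkTheory.
Context {R : realType}.

Implicit Types V W : normedModType R.

(** The first-order expansion of [f] at [x] is one of [g] as well; [diff_unique] then identifies
    ['d g x] with the continuous map ['d f x]. *)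
Lemma near_eq_differentiable {V W} (f g : V -> W) (x : V) :
  {near x, f =1 g} -> differentiable f x -> differentiable g x.
Proof.
move=> fg /diff_locallyP[cdf df]; have fgx : f x = g x := nbhs_singleton fg.
have fg0 : \forall h \near (0 : V), f (h + x) = g (h + x).
  suff shx : (fun h : V => h + x) @ (0 : V) --> x by exact: shx fg.
  by rewrite -[X in _ --> X]add0r; apply: cvgD; [exact: cvg_id|exact: cvg_cst].
have dg : g \o shift x = cst (g x) + 'd f x +o_ 0 id.
  apply/eqaddoP => _/posnumP[e].
  move/eqaddoP : df => /(_ e%:num [gt0 of e%:num]); apply: filter_app.
  by apply: filterS fg0 => h /=; rewrite -fgx !fctE /= => ->.
have dgE := @diff_unique R V W g ('d f x) x cdf dg.
apply/diff_locallyP; split; first by rewrite dgE.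
by rewrite dgE.
Qed.

Lemma open_near_eq {V} {T : Type} (U : set V) (f g : V -> T) x :
  open U -> (forall y, U y -> f y = g y) -> U x -> {near x, f =1 g}.
Proof. by move=> oU fg Ux; apply: filterS (open_nbhs_nbhs (conj oU Ux)). Qed.

(** Derivatives at a point of [U] see only nearby values, and these lie in [U] because [U] is
    open. *)
Lemma Ck_ext {V W} k (U : set V) (f g : V -> W) : open U ->
  (forall x, U x -> f x = g x) -> Ck k U f -> Ck k U g.
Proof.
move=> oU; elim: k f g => [|k IH] f g fg /=.
  move=> cf x Ux; change (g @ x --> g x); rewrite -fg//.
  apply: cvg_trans (cf x Ux); apply: near_eq_cvg.
  exact: open_near_eq oU fg Ux.
move=> [df Df]; split=> [x Ux|v].
  by apply: near_eq_differentiable (df x Ux); exact: open_near_eq Ux.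
apply: IH (Df v) => x Ux; apply: near_eq_derive.
exact: open_near_eq oU fg Ux.
Qed.

Lemma Ck_continuous {V W} k (U : set V) (f : V -> W) x :
  Ck k U f -> U x -> {for x, continuous f}.
Proof.
case: k => [|k] /=; first exact.
by move=> [df _] Ux; exact: differentiable_continuous (df x Ux).
Qed.

Lemma CkS {V W} k (U : set V) (f : V -> W) : Ck k.+1 U f -> Ck k U f.
Proof.
elim: k f => [|k IH] f /=.
  by move=> [df _] x Ux; exact: differentiable_continuous (df x Ux).
by move=> [df Df]; split=> // v; apply: IH.
Qed.

Lemma Ck_cst {V W} k (U : set V) (w : W) : Ck k U (cst w).
Proof.
elim: k w => [|k IH] w /=; first by move=> x _; exact: cvg_cst.
split=> [x _|v]; first exact: differentiable_cst.
by rewrite (_ : (fun _ => _) = cst 0) //; apply/funext => x; rewrite derive_cst.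
Qed.

Lemma Ck_linear {V W} k (U : set V) (f : {linear V -> W}) :
  continuous f -> Ck k U f.
Proof.
move=> cf; case: k => [|k] /=; first by move=> x _; exact: cf.
split=> [x _|v]; first exact: linear_differentiable.
rewrite (_ : (fun _ => _) = cst (f v)); first exact: Ck_cst.
apply/funext => x; rewrite deriveE ?diff_lin//; exact: linear_differentiable.
Qed.

Lemma CkD {V W} k (U : set V) (f g : V -> W) : open U ->
  Ck k U f -> Ck k U g -> Ck k U (f \+ g).
Proof.
move=> oU; elim: k f g => [|k IH] f g /=.
  by move=> cf cg x Ux; apply: cvgD; [exact: cf|exact: cg].
move=> [df Df] [dg Dg]; split=> [x Ux|v].
  by apply: differentiableD; [exact: df|exact: dg].
apply: Ck_ext (IH _ _ (Df v) (Dg v)) => // x Ux /=.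
by rewrite [RHS]deriveD//; apply: diff_derivable; [exact: df|exact: dg].
Qed.

Lemma CkM {V} k (U : set V) (f g : V -> R) : open U ->
  Ck k U f -> Ck k U g -> Ck k U (f \* g).
Proof.
move=> oU; elim: k f g => [|k IH] f g.
  by move=> cf cg x Ux; apply: cvgM; [exact: cf|exact: cg].
move=> cf cg; have [df Df] := cf; have [dg Dg] := cg; split=> [x Ux|v].
  by apply: differentiableM; [exact: df|exact: dg].
have := CkD oU (IH _ _ (CkS cf) (Dg v)) (IH _ _ (CkS cg) (Df v)).
apply: Ck_ext => // x Ux /=.
by rewrite [RHS]deriveM//; apply: diff_derivable; [exact: df|exact: dg].
Qed.

Lemma Ck_sum {V} {I : Type} k (U : set V) (r : seq I) (P : pred I)
    (F : I -> V -> R) : open U ->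
  (forall i, Ck k U (F i)) -> Ck k U (fun x => \sum_(i <- r | P i) F i x).
Proof.
move=> oU cF; elim: r => [|i r IH].
  apply: (Ck_ext oU _ (Ck_cst k U (0 : R))) => x _; by rewrite big_nil.
case Pi : (P i); last by apply: (Ck_ext oU _ IH) => x _; rewrite big_cons Pi.
by apply: (Ck_ext oU _ (CkD oU (cF i) IH)) => x _ /=; rewrite big_cons Pi.
Qed.

Lemma derive_comp {V} (f : V -> R) (g : R -> R) x v dg :
  differentiable f x -> is_derive (f x) 1 g dg ->
  differentiable (g \o f) x /\ 'D_v (g \o f) x = dg * 'D_v f x.
Proof.
move=> df [dgx <-]; have dg' : differentiable g (f x) by apply/derivable1_diffP.
split; first exact: differentiable_comp.
have lin t : 'd g (f x) t = 'd g (f x) 1 * t.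
  have /= := linearZ_LR ('d g (f x)) t (1 : R).
  by rewrite /GRing.scale /= mulr1 => ->; rewrite mulrC.
by rewrite (deriveE v (differentiable_comp df dg')) diff_comp// /= lin !deriveE.
Qed.

(** The outer derivative is [expR] again, so the induction closes without a general chain rule.
    Inversion likewise reproduces itself, and [ln] leads to inversion; real powers are assembled
    from these. *)
Lemma Ck_comp_expR {V} k (U : set V) (f : V -> R) : open U ->
  Ck k U f -> Ck k U (expR \o f).
Proof.
move=> oU; elim: k f => [|k IH] f.
  by move=> cf x Ux; apply: continuous_comp; [exact: cf|exact: continuous_expR].
move=> cf; have [df Df] := cf; split=> [x Ux|v].
  by have [] := derive_comp 0 (df x Ux) (is_derive_expR (f x)).
apply: Ck_ext (CkM oU (IH _ (CkS cf)) (Df v)) => // x Ux /=.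
by have [_ ->] := derive_comp v (df x Ux) (is_derive_expR (f x)).
Qed.

Lemma Ck_compV {V} k (U : set V) (f : V -> R) : open U ->
  (forall x, U x -> f x != 0) -> Ck k U f -> Ck k U (fun x => (f x)^-1).
Proof.
move=> oU; elim: k f => [|k IH] f f0.
  by move=> cf x Ux; apply: cvgV; [exact: f0|exact: cf].
move=> cf; have [df Df] := cf; split=> [x Ux|v].
  by apply: differentiableV; [exact: df|exact: f0].
have cV := IH _ f0 (CkS cf).
apply: (Ck_ext oU _ (CkM oU (Ck_cst k U (-1 : R)) (CkM oU (CkM oU cV cV) (Df v)))) => x Ux /=.
rewrite [RHS]deriveV//; [|exact: f0|exact/diff_derivable/df].
by rewrite /= mulN1r scaleNr -invfM.
Qed.

Lemma Ck_comp_ln {V} k (U : set V) (f : V -> R) : open U ->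
  (forall x, U x -> 0 < f x) -> Ck k U f -> Ck k U (@ln R \o f).
Proof.
move=> oU; case: k => [|k] f0.
  by move=> cf x Ux; apply: continuous_comp; [exact: cf|exact/continuous_ln/f0].
move=> cf; have [df Df] := cf; split=> [x Ux|v].
  by have [] := derive_comp 0 (df x Ux) (is_derive1_ln (f0 x Ux)).
have f0' x : U x -> f x != 0 by move=> /f0 /lt0r_neq0.
apply: Ck_ext (CkM oU (Ck_compV oU f0' (CkS cf)) (Df v)) => // x Ux /=.
by have [_ ->] := derive_comp v (df x Ux) (is_derive1_ln (f0 x Ux)).
Qed.

(** Serves to pull functions of the base coordinates back along [fst] to the coordinates of the
    tangent bundle. *)
Lemma Ck_comp_linear {V V' W} k (U : set V) (f : V -> W) (h : {linear V' -> V}) :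
  open U -> continuous h -> Ck k U f -> Ck k (h @^-1` U) (f \o h).
Proof.
move=> oU ch; have oU' : open (h @^-1` U) by exact: open_comp.
elim: k f => [|k IH] f.
  by move=> cf x Ux; apply: continuous_comp; [exact: ch|exact: cf].
move=> [df Df].
have dfh x : U (h x) -> differentiable (f \o h) x.
  by move=> Ux; apply: differentiable_comp; [exact: linear_differentiable|exact: df].
split=> [x /dfh//|v].
apply: (Ck_ext oU' _ (IH _ (Df (h v)))) => x Ux /=.
rewrite (deriveE v (dfh x Ux)) diff_comp; [|exact: linear_differentiable|exact: df].
by rewrite /= diff_lin// deriveE//; exact: df.
Qed.

Lemma Ck_entry {V} {m n} k (U : set V) (f : V -> 'M[R]_(m, n)) i j : open U ->
  Ck k U f -> Ck k U (fun x => f x i j).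
Proof.
move=> oU; elim: k f => [|k IH] f.
  by move=> cf x Ux; exact: (cvg_comp _ _ (cf x Ux) (@coord_continuous _ _ _ i j (f x))).
move=> [df Df]; split=> [x Ux|v].
  exact: (differentiable_comp (df x Ux) (differentiable_coord _ _ _)).
apply: Ck_ext (IH _ (Df v)) => // x Ux /=.
by rewrite derive_mx ?mxE//; exact/diff_derivable/df.
Qed.
Lemma Ck_sub {V W} k (U U' : set V) (f : V -> W) :
  U' `<=` U -> Ck k U f -> Ck k U' f.
Proof.
move=> UU; elim: k f => [|k IH] f /=; first by move=> cf x /UU; exact: cf.
by move=> [df Df]; split=> [x /UU/df//|v]; exact: IH.
Qed.

End CkTheory.

(** * Lorentzian forms *)

Section BilinearForm.
Context {R : realType} {n : nat}.
Implicit Types (k : R) (G P : 'M[R]_n) (u v w : 'rV[R]_n).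

Definition bil G u v : R := (u *m G *m v^T) 0 0.

Lemma bilDl G u v w : bil G (u + v) w = bil G u w + bil G v w.
Proof. by rewrite /bil !mulmxDl mxE. Qed.

Lemma bilDr G u v w : bil G u (v + w) = bil G u v + bil G u w.
Proof. by rewrite /bil linearD mulmxDr mxE. Qed.

Lemma bilZl G k u v : bil G (k *: u) v = k * bil G u v.
Proof. by rewrite /bil -!scalemxAl mxE. Qed.

Lemma bilZr G k u v : bil G u (k *: v) = k * bil G u v.
Proof. by rewrite /bil linearZ -scalemxAr mxE. Qed.

Lemma bilNl G u v : bil G (- u) v = - bil G u v.
Proof. by rewrite -scaleN1r bilZl mulN1r. Qed.

Lemma bilNr G u v : bil G u (- v) = - bil G u v.
Proof. by rewrite -scaleN1r bilZr mulN1r. Qed.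

Lemma bil_addmx G G' u v : bil (G + G') u v = bil G u v + bil G' u v.
Proof. by rewrite /bil mulmxDr mulmxDl mxE. Qed.

Lemma bil_scalemx k G u v : bil (k *: G) u v = k * bil G u v.
Proof. by rewrite /bil -scalemxAr -scalemxAl mxE. Qed.

Definition bilE := (bilDl, bilDr, bilNl, bilNr, bilZl, bilZr).

Lemma bil0l G u : bil G 0 u = 0.
Proof. by rewrite /bil !mul0mx mxE. Qed.

Lemma bil0r G u : bil G u 0 = 0.
Proof. by rewrite /bil trmx0 mulmx0 mxE. Qed.

Lemma bilC G u v : G^T = G -> bil G u v = bil G v u.
Proof.
move=> symG; transitivity ((u *m G *m v^T)^T 0 0); first by rewrite mxE.
by rewrite !trmx_mul trmxK symG mulmxA.
Qed.

Lemma bil_congr G P u v : bil (P *m G *m P^T) u v = bil G (u *m P) (v *m P).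
Proof. by rewrite /bil trmx_mul !mulmxA. Qed.

Lemma bil_row G P i j : bil G (row i P) (row j P) = (P *m G *m P^T) i j.
Proof.
rewrite /bil -row_mul mxE [RHS]mxE; apply: eq_bigr => k _.
by rewrite !mxE.
Qed.
End BilinearForm.

(** The sum of the squares [(c x_i - b y_i)^2] equals [c (c a - b^2)], which settles [c > 0]; for
    [c = 0] all [y_i] vanish. *)
Lemma sum_CauchySchwarz (R : realFieldType) (I : finType) (x y : I -> R) :
  (\sum_i x i * y i) ^+ 2 <= (\sum_i x i ^+ 2) * (\sum_i y i ^+ 2).
Proof.
set b := \sum_i x i * y i; set a := \sum_i x i ^+ 2; set c := \sum_i y i ^+ 2.
have c0 : 0 <= c by apply: sumr_ge0 => i _; exact: sqr_ge0.
have : 0 <= \sum_i (c * x i - b * y i) ^+ 2.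
  by apply: sumr_ge0 => i _; exact: sqr_ge0.
have -> : \sum_i (c * x i - b * y i) ^+ 2 = c * (c * a - b ^+ 2).
  transitivity (\sum_i (c ^+ 2 * x i ^+ 2 + (- 2 * c * b) * (x i * y i)
      + b ^+ 2 * y i ^+ 2)); first by apply: eq_bigr => i _; ring.
  by rewrite !big_split -!mulr_sumr /= -/a -/b -/c; ring.
move: c0; rewrite le_eqVlt => /predU1P[c0|c0]; last first.
  by rewrite pmulr_rge0// subr_ge0 mulrC.
move=> _; have y0 i : y i = 0.
  have := psumr_eq0P (fun i _ => sqr_ge0 (y i)) (esym c0) (erefl _ : xpredT i).
  by move/eqP; rewrite sqrf_eq0 => /eqP.
by rewrite -c0 mulr0 /b big1 ?expr0n// => i _; rewrite y0 mulr0.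
Qed.

(** * Diagonalization and signature of symmetric matrices *)

Section Gram.
Context {R : realType}.

(** One step of Gram-Schmidt. That [P] fixes the first basis vector lets the Lorentzian criterion
    keep track of its timelike vector. *)
Lemma schur_complement n (G : 'M[R]_(1 + n)) : G^T = G -> G 0 0 != 0 ->
  exists P (T : 'M[R]_n),
    [/\ P \in unitmx, T^T = T, row_mx 1%:M 0 *m P = row_mx (1%:M : 'M[R]_1) 0
      & P *m G *m P^T = block_mx (G 0 0)%:M 0 0 T].
Proof.
move=> symG g0; set g := G 0 0 in g0 *.
have ulG : ulsubmx G = g%:M.
  apply/matrixP => i j; rewrite !ord1 !mxE eqxx mulr1n.
  by congr (G _ _); apply/val_inj.
have dlG : dlsubmx G = (ursubmx G)^T by rewrite trmx_ursub symG.
set r := ursubmx G in dlG; set S := drsubmx G.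
have symS : S^T = S by rewrite /S trmx_drsub symG.
have GE : G = block_mx g%:M r r^T S by rewrite -ulG -dlG submxK.
exists (block_mx 1%:M 0 (- g^-1 *: r^T) 1%:M), (S - g^-1 *: (r^T *m r)).
split.
- by rewrite unitmxE det_lblock !det1 mulr1 unitr1.
- by rewrite linearB /= linearZ /= trmx_mul trmxK symS.
- by rewrite mul_row_block !mul1mx !mul0mx !addr0.
- rewrite GE tr_block_mx !mulmx_block !trmx1 !trmx0 !mul1mx !mul0mx !mulmx1 !mulmx0.
  rewrite !addr0 linearZ /= trmxK mul_mx_scalar -!scalemxAl -!scalemxAr mul_scalar_mx.
  rewrite !scalerA !mulrN !mulNr !divff// !scaleNr !scale1r mulVf// scale1r.
  by rewrite !addNr mul0mx scaler0 oppr0 add0r addrC.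
Qed.

Lemma posdef_gram n (G : 'M[R]_n) : G^T = G ->
  (forall v, v != 0 -> 0 < bil G v v) ->
  exists2 P, P \in unitmx & P *m G *m P^T = 1%:M.
Proof.
elim: n G => [|n IH].
  by move=> G _ _; exists 1%:M; [exact: unitmx1|apply/matrixP => -[]].
rewrite -[n.+1]/(1 + n)%N => G symG posG.
have g_gt0 : 0 < G 0 0.
  have := posG (row 0 1%:M); rewrite bil_row mul1mx trmx1 mulmx1; apply.
  apply/eqP => /matrixP/(_ 0 0); rewrite !mxE eqxx => /eqP.
  by rewrite oner_eq0.
have [P1 [T [uP1 symT _ PGP]]] := schur_complement symG (lt0r_neq0 g_gt0).
have posT z : z != 0 -> 0 < bil T z z.
  move=> z0; have -> : bil T z z = bil G (row_mx 0 z *m P1) (row_mx 0 z *m P1).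
    rewrite -bil_congr PGP /bil mul_row_block tr_row_mx mul_row_col.
    by rewrite !mul0mx !mulmx0 trmx0 mulmx0 !add0r.
  apply: posG; apply: contra z0 => /eqP zP.
  have /(congr1 (mulmx^~ (invmx P1))) := zP.
  by rewrite mulmxK// mul0mx => /(congr1 rsubmx); rewrite row_mxKr linear0 => ->.
have [P2 uP2 P2T] := IH T symT posT.
have sg : Num.sqrt (G 0 0) != 0 by rewrite sqrtr_eq0 -ltNge.
exists (block_mx (Num.sqrt (G 0 0))^-1%:M 0 0 P2 *m P1).
  rewrite unitmx_mul uP1 andbT unitmxE det_lblock det_scalar1 unitrM.
  by rewrite -unitmxE uP2 andbT unitfE invr_eq0.
rewrite trmx_mul mulmxA -(mulmxA _ P1) -(mulmxA _ (P1 *m G)) PGP.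
rewrite tr_block_mx !mulmx_block !trmx0 !mulmx0 !mul0mx !addr0 !add0r P2T.
rewrite mul0mx tr_scalar_mx -!scalar_mxM.
have -> : (Num.sqrt (G 0 0))^-1 * G 0 0 * (Num.sqrt (G 0 0))^-1 = 1.
  by rewrite mulrAC -invfM -expr2 sqr_sqrtr ?mulVf ?ltW// lt0r_neq0.
by rewrite mul0mx -scalar_mx_block.
Qed.

(** In a basis starting with a multiple of [v], the Schur complement represents the form on the
    orthogonal complement of [v]; its opposite is positive definite, hence congruent to the
    identity. *)
Lemma lorentzian_form_criterion n (G : 'M[R]_n.+1) v : G^T = G ->
  0 < bil G v v -> (forall w, w != 0 -> bil G v w = 0 -> bil G w w < 0) ->
  lorentzian_form G.
Proof.
rewrite -[n.+1]/(1 + n)%N in G v * => symG vpos orth.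
have v0 : v != 0 by apply: contraTneq vpos => ->; rewrite bil0l ltxx.
pose E := row_ebase v; have uE : E \in unitmx by exact: row_ebase_unit.
(* As [v] has rank 1, its rank factorization makes it a multiple of the first row of the invertible
   matrix [E]. *)
have [k vE] : exists k, v = k *: (row_mx 1%:M 0 *m E).
  exists (col_ebase v 0 0).
  have rv : \rank v = 1%N by rewrite rank_rV v0.
  rewrite -{1}(mulmx_ebase v) rv [col_ebase v]mx11_scalar -mulmxA mul_scalar_mx.
  rewrite !mxE eqxx mulr1n; congr (_ *: (_ *m _)).
  by rewrite -[LHS]/(@pid_mx R 1 (1 + n) 1) pid_mx_row.
have k0 : k != 0 by apply: contraNneq v0 => k0; rewrite vE k0 scale0r.
pose H := E *m G *m E^T.
have symH : H^T = H by rewrite /H !trmx_mul trmxK symG mulmxA.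
have H00 : 0 < H 0 0.
  have : 0 < k ^+ 2 * H 0 0.
    suff -> : H 0 0 = bil H (row_mx 1%:M 0) (row_mx 1%:M 0).
      by rewrite bil_congr; move: vpos; rewrite vE bilZl bilZr mulrA.
    rewrite -[H]submxK /bil mul_row_block tr_row_mx mul_row_col.
    rewrite trmx0 trmx1 !mul1mx !mul0mx !mulmx1 !mulmx0 !addr0 submxK !mxE.
    by have -> : lshift n (0 : 'I_1) = 0 by exact: val_inj.
  by rewrite pmulr_rgt0// exprn_even_gt0.
have [P1 [T [uP1 symT P1row PHP]]] := schur_complement symH (lt0r_neq0 H00).
have posT z : z != 0 -> 0 < bil (- T) z z.
  move=> z0; pose w := row_mx 0 z *m P1 *m E.
  have -> : bil (- T) z z = - bil G w w.
    rewrite /w -!bil_congr PHP /bil mul_row_block tr_row_mx mul_row_col.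
    by rewrite !mul0mx !mulmx0 trmx0 mulmx0 !add0r mulmxN mulNmx mxE.
  rewrite oppr_gt0; apply: orth.
    apply: contra z0 => /eqP zP.
    have /(congr1 (fun w => w *m invmx E *m (invmx P1))) := zP.
    rewrite !mulmxK// !mul0mx => /(congr1 rsubmx).
    by rewrite row_mxKr linear0 => ->.
  rewrite vE -P1row bilZl /w -!bil_congr PHP /bil mul_row_block tr_row_mx mul_row_col.
  by rewrite !mul0mx !mulmx0 trmx0 mulmx0 addr0 add0r !(mul0mx, mxE) mulr0.
have symNT : (- T)^T = - T by rewrite linearN /= symT.
have [P2 uP2 P2T] := posdef_gram symNT posT.
have sg : Num.sqrt (H 0 0) != 0 by rewrite sqrtr_eq0 -ltNge.
exists (block_mx (Num.sqrt (H 0 0))^-1%:M 0 0 P2 *m P1 *m E).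
  rewrite !unitmx_mul uP1 uE !andbT unitmxE det_lblock det_scalar1 unitrM.
  by rewrite -unitmxE uP2 andbT unitfE invr_eq0.
rewrite trmx_mul mulmxA -(mulmxA _ E) -(mulmxA _ (E *m G)) -/H.
rewrite trmx_mul mulmxA -(mulmxA _ P1) -(mulmxA _ (P1 *m H)) PHP.
rewrite tr_block_mx !mulmx_block !trmx0 !mulmx0 !mul0mx !addr0 !add0r.
rewrite mul0mx tr_scalar_mx -!scalar_mxM.
have -> : P2 *m T *m P2^T = - 1%:M by rewrite -P2T mulmxN mulNmx opprK.
have -> : (Num.sqrt (H 0 0))^-1 * H 0 0 * (Num.sqrt (H 0 0))^-1 = 1.
  by rewrite mulrAC -invfM -expr2 sqr_sqrtr ?mulVf ?ltW// lt0r_neq0.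
rewrite mul0mx; apply/matrixP => i j.
case: (split_ordP i) => i' ->; case: (split_ordP j) => j' ->;
  rewrite ?(block_mxEul, block_mxEur, block_mxEdl, block_mxEdr) !mxE.
- by rewrite !ord1 /= ?eqxx ?mulr1n.
- by rewrite eq_lrshift.
- by rewrite eq_rlshift.
- by rewrite (inj_eq (@rshift_inj _ _)) /=; case: (i' == j'); rewrite ?mulr1n ?mulr0n ?oppr0.
Qed.

Lemma lorentzian_form_orthonormal n (G : 'M[R]_n.+1) : lorentzian_form G ->
  exists P, [/\ P \in unitmx, bil G (row 0 P) (row 0 P) = 1,
    forall i, i != 0 -> bil G (row i P) (row i P) = -1
    & forall i j, i != j -> bil G (row i P) (row j P) = 0].
Proof.
move=> [P uP PGP]; exists P; split => //.
- by rewrite bil_row PGP !mxE.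
- by move=> i i0; rewrite bil_row PGP !mxE eqxx mulr1n -val_eqE /= in i0 *; rewrite (negbTE i0).
- by move=> i j /negbTE ij; rewrite bil_row PGP !mxE ij mulr0n.
Qed.

Lemma lorentzian_form_unit n (G : 'M[R]_n) : lorentzian_form G -> G \in unitmx.
Proof.
move=> [P uP PGP]; have : P *m G *m P^T \in unitmx.
  rewrite PGP unitmxE det_diag unitfE; apply/prodf_neq0 => i _.
  by rewrite mxE; case: ifP => _; rewrite ?oppr_eq0 oner_neq0.
by rewrite !unitmx_mul => /andP[/andP[]].
Qed.

(** * Inequalities for timelike and causal vectors *)

Section Lorentzian.
Variables (n : nat) (G : 'M[R]_n.+1).
Hypotheses (symG : G^T = G) (lorG : lorentzian_form G).
Implicit Types u v w : 'rV[R]_n.+1.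
Local Notation "'[ u , v ]" := (bil G u v).

(** In an orthonormal frame let [x], [y] be the time coordinates of [v], [w] and [a], [c] the
    squared lengths of their spatial parts. Orthogonality and Cauchy-Schwarz give [x^2 y^2 <= a c],
    and [a < x^2]; so [y^2 < c], unless [c = 0], which forces [w = 0]. *)
Lemma lorentz_orth v w : 0 < '[v, v] -> '[v, w] = 0 -> w != 0 -> '[w, w] < 0.
Proof.
case: lorG => P uP PGP; pose X u := u *m invmx P.
have bX u u' : '[u, u'] = X u 0 0 * X u' 0 0 -
    \sum_(i < n) X u 0 (lift ord0 i) * X u' 0 (lift ord0 i).
  have -> : '[u, u'] = bil (P *m G *m P^T) (X u) (X u').
    by rewrite bil_congr /X !mulmxKV.
  rewrite PGP /bil mul_mx_diag !mxE big_ord_recl !mxE /= mulr1; congr (_ + _).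
  by rewrite -sumrN; apply: eq_bigr => i _; rewrite !mxE /= mulrN1 mulNr.
have X0 u : X u = 0 -> u = 0 by move=> Xu; rewrite -[u](mulmxKV uP) -/(X u) Xu mul0mx.
rewrite !bX => vpos vw w0.
have CS := sum_CauchySchwarz (fun i => X v 0 (lift ord0 i)) (fun i => X w 0 (lift ord0 i)).
move: vpos vw CS.
set a := \sum_i X v _ _ * X v _ _; set b := \sum_i X v _ _ * X w _ _.
set c := \sum_i X w _ _ * X w _ _ => vpos vw CS.
have c0 : 0 <= c by apply: sumr_ge0 => i _; exact: sqr_ge0.
have {}CS : b ^+ 2 <= a * c by exact: CS.
set x := X v 0 0 in vpos vw *; set y := X w 0 0 in vw *.
have bE : b = x * y by apply/esym/eqP; rewrite -subr_eq0 vw.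
have x2 : 0 < x ^+ 2.
  by apply: lt_le_trans vpos _; rewrite -expr2 gerBl; apply: sumr_ge0 => i _; exact: sqr_ge0.
move: c0; rewrite le_eqVlt => /predU1P[c0|c0]; last first.
  rewrite subr_lt0 -(ltr_pM2l x2); apply: le_lt_trans (_ : a * c < _).
    by have -> : x ^+ 2 * (y * y) = b ^+ 2 by rewrite bE; ring.
  by rewrite ltr_pM2r// -subr_gt0 expr2.
case/negP: w0; apply/eqP/X0; apply/rowP => i; rewrite [RHS]mxE.
have [j ->|->] := unliftP 0 i.
  have : X w 0 (lift ord0 j) ^+ 2 = 0 :=
    psumr_eq0P (fun i _ => sqr_ge0 (X w 0 (lift ord0 i))) (esym c0) (erefl _ : xpredT j).
  by move/eqP; rewrite sqrf_eq0 => /eqP.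
have : (x * y) ^+ 2 <= 0 by rewrite -bE; apply: le_trans CS _; rewrite -c0 mulr0.
rewrite exprMn pmulr_rle0// => y2; apply/eqP; rewrite -sqrf_eq0.
by rewrite eq_le y2 sqr_ge0.
Qed.

(** The difference of the two sides is [- '[v, v]] times the square of the component of [w]
    orthogonal to [v], which is negative unless that component vanishes. *)
Lemma lorentz_reverse_CS v w : 0 < '[v, v] ->
  '[v, v] * '[w, w] <= '[v, w] ^+ 2 ?= iff (w == ('[v, w] / '[v, v]) *: v).
Proof.
move=> vpos; have v0 := lt0r_neq0 vpos.
pose w' := w - ('[v, w] / '[v, v]) *: v.
have vw' : '[v, w'] = 0 by rewrite /w' !bilE; field.
have w'w' : '[v, w] ^+ 2 - '[v, v] * '[w, w] = - '[v, v] * '[w', w'].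
  by rewrite /w' !bilE [bil G w v]bilC//; field.
have w'0 : (w == ('[v, w] / '[v, v]) *: v) = (w' == 0) by rewrite subr_eq0.
split.
  rewrite -subr_ge0 w'w' mulNr oppr_ge0 pmulr_rle0//.
  have [->|/(lorentz_orth vpos vw')/ltW//] := eqVneq w' 0; by rewrite bil0l.
rewrite w'0 eq_sym -subr_eq0 w'w' mulf_eq0 oppr_eq0 (negbTE v0) /=.
have [->|/(lorentz_orth vpos vw')] := eqVneq w' 0; first by rewrite bil0l eqxx.
by move=> /lt_eqF ->.
Qed.

(** The ordinary Cauchy-Schwarz inequality: the form is negative definite on the orthogonal
    complement of [v]. *)
Lemma lorentz_orth_CS v w1 w2 : 0 < '[v, v] -> '[v, w1] = 0 -> '[v, w2] = 0 ->
  '[w1, w2] ^+ 2 <= '[w1, w1] * '[w2, w2].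
Proof.
move=> vpos vw1 vw2; have [->|w20] := eqVneq w2 0.
  by rewrite !bil0r mulr0 expr0n.
have w2neg := lorentz_orth vpos vw2 w20.
pose w := '[w2, w2] *: w1 - '[w1, w2] *: w2.
have vw : '[v, w] = 0 by rewrite /w !bilE vw1 vw2 !mulr0 subr0.
have ww : '[w, w] = '[w2, w2] * ('[w1, w1] * '[w2, w2] - '[w1, w2] ^+ 2).
  by rewrite /w !bilE [bil G w2 w1]bilC//; ring.
rewrite -subr_ge0 -(nmulr_rle0 _ w2neg) -ww.
have [->|/(lorentz_orth vpos vw)/ltW//] := eqVneq w 0; by rewrite bil0l.
Qed.

(** The combination [w] of [t] and [u] orthogonal to [v] satisfies ['[w, w] <= 0]; in the expansion
    the only term that can be negative is the one with ['[t, u]]. *)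
Lemma lorentz_same_cone v t u : 0 < '[v, v] -> 0 < '[t, t] -> 0 <= '[u, u] ->
  0 < '[v, t] -> 0 < '[v, u] -> 0 < '[t, u].
Proof.
move=> vv tt uu vt vu; pose w := '[v, u] *: t - '[v, t] *: u.
have vw : '[v, w] = 0 by rewrite /w !bilE; ring.
have : '[w, w] <= 0.
  have [->|/(lorentz_orth vv vw)/ltW//] := eqVneq w 0; by rewrite bil0l.
have -> : '[w, w] = '[v, u] ^+ 2 * '[t, t] + '[v, t] ^+ 2 * '[u, u]
    - (2 * '[v, u] * '[v, t]) * '[t, u].
  by rewrite /w !bilE [bil G u t]bilC//; ring.
rewrite subr_le0 => h; rewrite -(pmulr_rgt0 _ (_ : 0 < 2 * '[v, u] * '[v, t])).
  apply: lt_le_trans h; apply: ltr_wpDr; first exact: mulr_ge0 (sqr_ge0 _) uu.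
  by rewrite mulr_gt0 ?exprn_gt0.
by rewrite !mulr_gt0.
Qed.

(* Apply [lorentz_same_cone] to the reflection [2 '[v, u] / '[v, v] v - u]. *)
Lemma lorentz_cone_bound v t u : 0 < '[v, v] -> 0 < '[t, t] -> 0 <= '[u, u] ->
  0 < '[v, t] -> 0 < '[v, u] -> '[v, v] * '[t, u] < 2 * '[v, t] * '[v, u].
Proof.
move=> vv tt uu vt vu; have v0 := lt0r_neq0 vv.
pose u' := (2 * '[v, u] / '[v, v]) *: v - u.
have u'u' : '[u', u'] = '[u, u] by rewrite /u' !bilE [bil G u v]bilC//; field.
have vu' : '[v, u'] = '[v, u] by rewrite /u' !bilE; field.
have : 0 < '[t, u'] by apply: lorentz_same_cone vv tt _ vt _; rewrite ?u'u' ?vu'.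
rewrite /u' !bilE [bil G t v]bilC// subr_gt0 -(ltr_pM2l vv).
by congr (_ < _); field.
Qed.

Lemma lorentz_causal_neq0 v u : 0 < '[v, v] -> 0 <= '[u, u] -> u != 0 ->
  '[v, u] != 0.
Proof.
move=> vv uu u0; apply/eqP => vu.
by have := lorentz_orth vv vu u0; rewrite ltNge uu.
Qed.
End Lorentzian.
End Gram.

(** * The Hessian of a Bogoslovsky-Kropina function *)

Section BKCalculus.
Context {R : realType} {n : nat}.

Definition dot (b u : 'rV[R]_n) : R := (u *m b^T) 0 0.

Definition bk (a : 'M[R]_n) (b : 'rV[R]_n) (q : R) (u : 'rV[R]_n) : R :=
  bil a u u * (dot b u ^+ 2 / bil a u u) `^ q.

Definition bk_domain (a : 'M[R]_n) (b : 'rV[R]_n) : set 'rV[R]_n :=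
  [set u | 0 < bil a u u /\ dot b u != 0].

Lemma Ck_bil (V : normedModType R) k (U : set V) (G : V -> 'M[R]_n)
    (u w : V -> 'rV[R]_n) : open U -> Ck k U G -> Ck k U u -> Ck k U w ->
  Ck k U (fun x => bil (G x) (u x) (w x)).
Proof.
move=> oU cG cu cw.
have E x : U x -> \sum_j (\sum_i u x 0 i * G x i j) * w x 0 j =
    bil (G x) (u x) (w x).
  move=> _; rewrite /bil mxE; apply: eq_bigr => j _; rewrite !mxE.
  by congr (_ * _); rewrite mxE.
apply: (Ck_ext oU E); apply: Ck_sum => // j; apply: CkM => //.
  by apply: Ck_sum => // i; apply: CkM => //; exact: Ck_entry.
exact: Ck_entry.
Qed.

Lemma Ck_dot (V : normedModType R) k (U : set V) (b u : V -> 'rV[R]_n) :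
  open U -> Ck k U b -> Ck k U u -> Ck k U (fun x => dot (b x) (u x)).
Proof.
move=> oU cb cu.
have E x : U x -> \sum_j u x 0 j * b x 0 j = dot (b x) (u x).
  by move=> _; rewrite /dot mxE; apply: eq_bigr => j _; rewrite !mxE.
by apply: (Ck_ext oU E); apply: Ck_sum => // j; apply: CkM => //; exact: Ck_entry.
Qed.

Lemma ratio_gt0 a b u : bk_domain a b u -> 0 < dot b u ^+ 2 / bil a u u.
Proof. by move=> [A B]; rewrite divr_gt0 ?exprn_even_gt0. Qed.

(** The form and the covector depend on the parameter too, as their components in a chart depend on
    the base point. The power is written as [expR] of [q] times [ln]. *)
Lemma Ck_bk (V : normedModType R) k (U : set V) (a : V -> 'M[R]_n)
    (b u : V -> 'rV[R]_n) q : open U ->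
  (forall x, U x -> bk_domain (a x) (b x) (u x)) ->
  Ck k U a -> Ck k U b -> Ck k U u -> Ck k U (fun x => bk (a x) (b x) q (u x)).
Proof.
move=> oU dom ca cb cu.
have cA := Ck_bil oU ca cu cu; have cB := Ck_dot oU cb cu.
have A0 x : U x -> bil (a x) (u x) (u x) != 0.
  by move=> /dom[/lt0r_neq0].
have cs := CkM oU (CkM oU cB cB) (Ck_compV oU A0 cA).
have s0 x : U x -> 0 < ((fun x => dot (b x) (u x)) \* (fun x => dot (b x) (u x))
    \* (fun x => (bil (a x) (u x) (u x))^-1)) x.
  by move=> Ux /=; rewrite -expr2; exact/ratio_gt0/dom.
have := CkM oU cA (Ck_comp_expR oU (CkM oU (Ck_cst k U q) (Ck_comp_ln oU s0 cs))).
apply: Ck_ext => // x Ux; rewrite /= /bk /powR -expr2.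
by rewrite (gt_eqF (ratio_gt0 (dom x Ux))).
Qed.

Lemma continuous_id_rV : continuous (@idfun 'rV[R]_n).
Proof. by move=> x. Qed.

Lemma Ck_id k (U : set 'rV[R]_n) : Ck k U (fun u => u).
Proof. by have := Ck_linear k U continuous_id_rV. Qed.

Lemma Ck_quad k U (a : 'M[R]_n) : open U -> Ck k U (fun u => bil a u u).
Proof.
by move=> oU; apply: Ck_bil => //; [exact: Ck_cst|exact: Ck_id|exact: Ck_id].
Qed.

Lemma Ck_dotl k U b : open U -> Ck k U (dot b).
Proof. by move=> oU; apply: Ck_dot => //; [exact: Ck_cst|exact: Ck_id]. Qed.

Lemma continuous_quad (a : 'M[R]_n) : continuous (fun u => bil a u u).
Proof. by move=> u; exact: (Ck_continuous (Ck_quad 0 a openT)). Qed.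

Lemma continuous_bilr (a : 'M[R]_n) v : continuous (bil a v).
Proof.
move=> u; apply: (Ck_continuous (k := 0) (U := setT)) => //.
by apply: (Ck_bil openT); [exact: Ck_cst|exact: Ck_cst|exact: Ck_id].
Qed.

Lemma continuous_dot b : continuous (dot b).
Proof. by move=> u; exact: (Ck_continuous (Ck_dotl 0 b openT)). Qed.

Lemma open_bk_domain a b : open (bk_domain a b).
Proof.
apply: openI.
  apply: (@open_comp _ _ (fun u => bil a u u) [set x | 0 < x]); last exact: open_gt.
  by move=> u _; exact: continuous_quad.
apply: (@open_comp _ _ (dot b) [set x | x != 0]); last exact: open_neq.
by move=> u _; exact: continuous_dot.
Qed.

(** Along a line [A] is quadratic and [B] affine, so the difference quotient is exactly
    [d + h * e]. *)
Lemma is_derive_quadratic (f : 'rV[R]_n -> R) v w (d e : R) :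
  (forall h, f (h *: w + v) = f v + h * d + h ^+ 2 * e) -> is_derive v w f d.
Proof.
move=> fE.
have lim : h^-1 *: ((f \o shift v) (h *: w) - f v) @[h --> 0^'] --> d.
  have : d + h * e @[h --> 0^'] --> d.
    rewrite -[X in _ --> X]addr0 -[X in _ --> _ + X](mul0r e).
    apply: cvgD; first exact: cvg_cst.
    by apply: cvgM; [apply: cvg_within_filter; exact: cvg_id|exact: cvg_cst].
  apply: cvg_trans; apply: near_eq_cvg; near=> h.
  have h0 : h != 0 by near: h; exact: nbhs_dnbhs_neq.
  by rewrite /= fE /GRing.scale /=; field.
split; first by apply/cvg_ex; exists d.
exact/cvg_lim.
Unshelve. all: by end_near. Qed.

Lemma is_derive_quad (a : 'M[R]_n) v w : a^T = a ->
  is_derive v w (fun u => bil a u u) (2 * bil a v w).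
Proof.
move=> sa; apply: (@is_derive_quadratic _ _ _ _ (bil a w w)) => h.
by rewrite !bilE (bilC w v sa); ring.
Qed.

Lemma is_derive_bill (a : 'M[R]_n) v w w' :
  is_derive v w (fun u => bil a u w') (bil a w w').
Proof. by apply: (@is_derive_quadratic _ _ _ _ 0) => h; rewrite !bilE; ring. Qed.

Lemma dotD b u v : dot b (u + v) = dot b u + dot b v.
Proof. by rewrite /dot mulmxDl mxE. Qed.

Lemma dotZ b k u : dot b (k *: u) = k * dot b u.
Proof. by rewrite /dot -scalemxAl mxE. Qed.

Lemma is_derive_dot b v w : is_derive v w (dot b) (dot b w).
Proof.
by apply: (@is_derive_quadratic _ _ _ _ 0) => h; rewrite dotD dotZ; ring.
Qed.

Lemma is_derive_ratios (V : normedModType R) (f g h : V -> R) x v c c' df dg dh :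
  is_derive x v f df -> is_derive x v g dg -> is_derive x v h dh ->
  g x != 0 -> h x != 0 ->
  is_derive x v (fun u => 2 * (c * (f u / g u) + c' / h u))
    (2 * (c * (df / g x - f x * dg / g x ^+ 2) - c' * dh / h x ^+ 2)).
Proof.
move=> df' [g1 g2] [h1 h2] g0 h0.
have gV : is_derive x v (fun u => (g u)^-1) (- g x ^- 2 *: dg).
  by split; [exact: (derivableV g0 g1)|rewrite (deriveV g0 g1) g2].
have hV : is_derive x v (fun u => (h u)^-1) (- h x ^- 2 *: dh).
  by split; [exact: (derivableV h0 h1)|rewrite (deriveV h0 h1) h2].
apply: is_derive_eq (is_deriveZ 2 (is_deriveD (is_deriveZ c (is_deriveM df' gV))
  (is_deriveZ c' hV))) _.
by rewrite /GRing.scale /=; field; rewrite g0 h0.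
Qed.

Section Hessian.
Variables (a : 'M[R]_n) (b : 'rV[R]_n) (q : R).
Hypothesis sa : a^T = a.

(** The derivative along [w] of [ln L = (1 - q) ln A + q ln (B^2)]; it is rational in [u], so real
    powers survive only in the factor [L]. *)
Definition bk_logderive (w u : 'rV[R]_n) : R :=
  2 * ((1 - q) * (bil a u w / bil a u u) + q * (dot b w / dot b u)).

Lemma is_derive_bk v w : bk_domain a b v ->
  is_derive v w (bk a b q) (bk a b q v * bk_logderive w v).
Proof.
move=> dv; have [A B] := dv.
have oD := @open_bk_domain a b.
have B2 : 0 < dot b v ^+ 2 by rewrite exprn_even_gt0.
pose phi : 'rV[R]_n -> R := (1 - q) *: (@ln R \o (fun u => bil a u u)) +
  q *: (@ln R \o (fun u => dot b u ^+ 2)).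
have bkE u : bk_domain a b u -> expR (phi u) = bk a b q u.
  move=> du; have [Au Bu] := du; have Bu2 : 0 < dot b u ^+ 2 by rewrite exprn_even_gt0.
  rewrite /bk /powR gt_eqF ?ratio_gt0// -{1}[bil a u u]lnK// -expRD; congr expR.
  have -> : phi u = (1 - q) * ln (bil a u u) + q * ln (dot b u ^+ 2) by [].
  by rewrite ln_div//; ring.
apply: (near_eq_is_derive (f := expR \o phi)); first exact: open_near_eq dv.
have dA : differentiable (fun u => bil a u u) v by have [dA _] := Ck_quad 1 a openT; exact: dA.
have dB : differentiable (dot b) v by have [dB _] := Ck_dotl 1 b openT; exact: dB.
have [dlA lAE] := derive_comp w dA (is_derive1_ln A).
have sqE : (fun u => dot b u ^+ 2) = dot b * dot b.
  by apply/funext => u; rewrite expr2.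
have dsq : differentiable (fun u => dot b u ^+ 2) v.
  by rewrite sqE; exact: differentiableM.
have [dlB lBE] := derive_comp w dsq (is_derive1_ln B2).
have dB2 : 'D_w (fun u => dot b u ^+ 2) v = 2 * dot b v * dot b w.
  have [dBw dBE] := is_derive_dot b v w.
  by rewrite sqE deriveM// dBE /GRing.scale /=; ring.
have [_ dAE] := is_derive_quad v w sa.
have dphi : differentiable phi v.
  by apply: differentiableD; exact: differentiableZ.
have phiE : 'D_w phi v = bk_logderive w v.
  rewrite [LHS]deriveD ?deriveZ; try exact/diff_derivable/differentiableZ; try exact/diff_derivable.
  rewrite lAE lBE dB2 dAE.
  by rewrite /GRing.scale /bk_logderive /=; field; rewrite B lt0r_neq0.
have [dL LE] := derive_comp w dphi (is_derive_expR (phi v)).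
split; first exact: diff_derivable.
by rewrite LE phiE -bkE.
Qed.

Lemma is_derive_bk_logderive v w w' : bk_domain a b v ->
  is_derive v w' (bk_logderive w)
    (2 * ((1 - q) * (bil a w' w / bil a v v -
             2 * bil a v w * bil a v w' / bil a v v ^+ 2)
          - q * (dot b w * dot b w' / dot b v ^+ 2))).
Proof.
move=> [A B].
have := is_derive_ratios (1 - q) (q * dot b w) (is_derive_bill a v w' w)
  (is_derive_quad v w' sa) (is_derive_dot b v w') (lt0r_neq0 A) B.
have -> : bk_logderive w = (fun u => 2 * ((1 - q) * (bil a u w / bil a u u) +
    q * dot b w / dot b u)).
  by apply/funext => u; rewrite /bk_logderive mulrA.
by move/is_derive_eq; apply; field; rewrite B lt0r_neq0.
Qed.

(** Half the Hessian of [L] at [v], where [y] is the covector [a(v, .)]. With [l] the logarithmic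
    derivative it is [L / 2] times the sum of [l(w) l(w')] and the derivative of [l(w)] along
    [w']. *)
Definition bk_tensor (v : 'rV[R]_n) : 'M[R]_n :=
  let A := bil a v v in let B := dot b v in let y := v *m a in
  bk a b q v *: (((1 - q) / A) *: a
    - (2 * q * (1 - q) / A ^+ 2) *: (y^T *m y)
    + (2 * q * (1 - q) / (A * B)) *: (y^T *m b + b^T *m y)
    + (q * (2 * q - 1) / B ^+ 2) *: (b^T *m b)).

Lemma bk_tensorT v : (bk_tensor v)^T = bk_tensor v.
Proof.
rewrite /bk_tensor; move: (v *m a) => y; apply/matrixP => i j.
have aji : a j i = a i j by rewrite -{1}sa mxE.
by rewrite !mxE !big_ord1 !mxE aji; ring.
Qed.

Lemma bil_bk_tensor v w w' : bil (bk_tensor v) w w' = bk a b q v *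
  ((1 - q) * (bil a w w' / bil a v v)
   - 2 * q * (1 - q) * (bil a v w / bil a v v) * (bil a v w' / bil a v v)
   + 2 * q * (1 - q) * ((bil a v w / bil a v v) * (dot b w' / dot b v)
                      + (dot b w / dot b v) * (bil a v w' / bil a v v))
   + q * (2 * q - 1) * (dot b w / dot b v) * (dot b w' / dot b v)).
Proof.
have outer (y z : 'rV[R]_n) : bil (y^T *m z) w w' = dot y w * dot z w'.
  rewrite /bil mulmxA -mulmxA mxE big_ord1; congr (_ * _).
  by rewrite -[z]trmxK -trmx_mul mxE trmxK.
have doty u : dot (v *m a) u = bil a v u.
  by rewrite bilC// /dot /bil trmx_mul sa mulmxA.
rewrite /bk_tensor /= -scaleNr !(bil_addmx, bil_scalemx, outer, doty).
by rewrite !expr2 !invfM; ring.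
Qed.

Lemma derive2_bk v w w' : bk_domain a b v ->
  'D_w (fun u => 'D_w' (bk a b q) u) v = 2 * bil (bk_tensor v) w w'.
Proof.
move=> dv; have [A B] := dv; have A0 := lt0r_neq0 A.
have [dL LE] := is_derive_bk w dv.
have [dl lE] := is_derive_bk_logderive w' w dv.
have near_v : \near v, 'D_w' (bk a b q) v = (bk a b q * bk_logderive w') v.
  apply: (open_near_eq (@open_bk_domain a b)) dv => u du.
  by have [_ ->] := is_derive_bk w' du.
rewrite (near_eq_derive _ near_v) (deriveM dL dl) LE lE bil_bk_tensor /bk_logderive.
by rewrite /GRing.scale /=; field; rewrite A0 B.
Qed.
End Hessian.
End BKCalculus.

(** * Signature of the fundamental tensor *)

Section BKSignature.
Context {R : realType} {n : nat}.
Variables (a : 'M[R]_n.+2) (b : 'rV[R]_n.+2).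
Hypotheses (sa : a^T = a) (la : lorentzian_form a).
Implicit Types u v w : 'rV[R]_n.+2.

Definition dual_vec := b *m invmx a.
Local Notation N := dual_vec.

(** The number [<b, b>]; at a point of the manifold it is convertible to [sq_norm]. *)
Definition conorm : R := (b *m invmx a *m b^T) 0 0.

Lemma bil_dual u : bil a u N = dot b u.
Proof.
have ua := lorentzian_form_unit la.
by rewrite /bil /dot trmx_mul trmx_inv sa mulmxA mulmxK.
Qed.

Lemma dot_dual : dot b N = conorm.
Proof. by []. Qed.

Lemma conormE : bil a N N = conorm.
Proof. by rewrite bil_dual. Qed.

Lemma dual_vec_eq0 : (N == 0) = (b == 0).
Proof.
have ua := lorentzian_form_unit la.
apply/eqP/eqP => [|b0]; last by rewrite /N b0 mul0mx.
by move/(congr1 (mulmx^~ a)); rewrite mulmxKV// mul0mx.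
Qed.

Lemma bk_gt0 q v : bk_domain a b v -> 0 < bk a b q v.
Proof. by move=> dv; have [A _] := dv; rewrite mulr_gt0// powR_gt0// ratio_gt0. Qed.

Lemma bil_bk_tensorE q v w : bk_domain a b v ->
  let t := bil a v w / bil a v v in let s := dot b w / dot b v - t in
  let h := t ^+ 2 - bil a w w / bil a v v in
  bil (bk_tensor a b q v) w w =
    bk a b q v * ((t + q * s) ^+ 2 - (1 - q) * (h + q * s ^+ 2)).
Proof.
by move=> [A B] /=; rewrite bil_bk_tensor//; field; rewrite B lt0r_neq0.
Qed.

(** By homogeneity [g(v, .)] is half the differential of [L]. Hence [g(v, v) = L], and [w] is
    [g]-orthogonal to [v] iff [t + q s = 0], that is, iff the square in [bil_bk_tensorE]
    vanishes. *)
Lemma bil_bk_tensor_radial q v w : bk_domain a b v ->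
  bil (bk_tensor a b q v) v w = bk a b q v *
    ((1 - q) * (bil a v w / bil a v v) + q * (dot b w / dot b v)).
Proof.
by move=> [A B] /=; rewrite bil_bk_tensor//; field; rewrite B lt0r_neq0.
Qed.

Lemma conorm_le v : 0 < bil a v v -> bil a v v * conorm <= dot b v ^+ 2.
Proof.
by move=> A; rewrite -conormE -bil_dual; have [] := lorentz_reverse_CS sa la N A.
Qed.

(** As [g(v, v) = L > 0], it remains to show [h + q s^2 > 0] for nonzero [w] that are [g]-orthogonal
    to [v]. For [q < 0] this needs an upper bound of [s^2] by [h]. *)
Lemma bk_tensor_lorentzian q v : bk_domain a b v -> q < 1 ->
  0 < (1 + q) * dot b v ^+ 2 - q * conorm * bil a v v ->
  lorentzian_form (bk_tensor a b q v).
Proof.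
move=> dv q1 pos; have [A B] := dv; have L := bk_gt0 q dv.
have A0 := lt0r_neq0 A; have B2 : 0 < dot b v ^+ 2 by rewrite exprn_even_gt0.
apply: (@lorentzian_form_criterion _ _ _ v); first exact: bk_tensorT.
  by rewrite bil_bk_tensor_radial// !divff// !mulr1 subrK mulr1.
move=> w w0; rewrite bil_bk_tensor_radial// => /eqP.
rewrite mulf_eq0 (gt_eqF L) /= => /eqP tq; rewrite bil_bk_tensorE//.
rewrite pmulr_rlt0//.
set t := bil a v w / bil a v v in tq *; set be := dot b w / dot b v in tq *.
have -> : t + q * (be - t) = 0 by rewrite -tq; ring.
rewrite expr0n /= sub0r oppr_lt0 mulr_gt0 ?subr_gt0//.
set h := t ^+ 2 - _; set s := be - t.
have hE : bil a v v ^+ 2 * h = bil a v w ^+ 2 - bil a v v * bil a w w.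
  by rewrite /h /t; field.
have [CS CSeq] := lorentz_reverse_CS sa la w A.
have h0 : 0 <= h by rewrite -(pmulr_rge0 _ (exprn_gt0 2 A)) hE subr_ge0.
have sh : dot b v ^+ 2 * s ^+ 2 <= h * (dot b v ^+ 2 - bil a v v * conorm).
  (* [w1] and [w2] are [A] times the components of [w] and of the dual vector of [b] orthogonal to
     [v]; Cauchy-Schwarz for them, divided by [A^4], is the claim. *)
  pose w1 := bil a v v *: w - bil a v w *: v.
  pose w2 := bil a v v *: N - dot b v *: v.
  have vw1 : bil a v w1 = 0 by rewrite /w1 !bilE; ring.
  have vw2 : bil a v w2 = 0 by rewrite /w2 !bilE bil_dual; ring.
  have := lorentz_orth_CS sa la A vw1 vw2.
  have -> : bil a w1 w2 = bil a v v ^+ 2 * dot b v * s.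
    rewrite /w1 /w2 !bilE !bil_dual (bilC w v sa) /s /be /t.
    by field; rewrite B A0.
  have -> : bil a w1 w1 = - bil a v v ^+ 3 * h.
    by rewrite /w1 !bilE (bilC w v sa) /h /t; field.
  have -> : bil a w2 w2 = - bil a v v * (dot b v ^+ 2 - bil a v v * conorm).
    by rewrite /w2 !bilE (bilC N v sa) !bil_dual dot_dual; ring.
  move=> CS2; rewrite -(ler_pM2l (exprn_gt0 4 A)); move: CS2.
  by congr (_ <= _); ring.
(* If [h = 0], then [s = 0] by [sh] and [t = 0] by orthogonality, while equality in the reverse
   Cauchy-Schwarz inequality gives [w = t v = 0]. *)
have hpos : 0 < h.
  rewrite lt_neqAle h0 andbT eq_sym; apply/eqP => hz.
  have s0 : s = 0.
    apply/eqP; rewrite -sqrf_eq0 eq_le sqr_ge0 andbT -(pmulr_rle0 _ B2).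
    by rewrite (le_trans sh)// hz mul0r.
  have t0 : t = 0.
    have : t + q * s = 0 by rewrite -tq /s; ring.
    by rewrite s0 mulr0 addr0.
  move: CSeq; rewrite -/t t0 scale0r (negbTE w0).
  by rewrite eq_sym -subr_eq0 -hE hz mulr0 eqxx.
have [q0|q0] := leP 0 q; first by rewrite ltr_pwDl// mulr_ge0// sqr_ge0.
(* For [q < 0], [sh] bounds [B^2 (h + q s^2)] below by [h ((1 + q) B^2 - q <b, b> A)]. *)
rewrite -(pmulr_rgt0 _ B2) mulrDr.
apply: lt_le_trans (_ : h * ((1 + q) * dot b v ^+ 2 - q * conorm * bil a v v) <= _).
  by rewrite mulr_gt0.
have := ler_wnM2l (ltW q0) sh.
rewrite -subr_ge0 => sh'; rewrite -subr_ge0; apply: le_trans sh' _.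
by rewrite le_eqVlt; apply/orP; left; apply/eqP; ring.
Qed.

(** In dimension at least two a Lorentzian form takes a negative value, whereas for [q >= 1] both
    terms of [g] in [bil_bk_tensorE] are nonnegative, as [h >= 0]. *)
Lemma lorentzian_bk_tensor_lt1 q v : bk_domain a b v ->
  lorentzian_form (bk_tensor a b q v) -> q < 1.
Proof.
move=> dv lg; have [A B] := dv; have L := bk_gt0 q dv.
have [P [_ _ /(_ (lift 0 0) isT) neg _]] := lorentzian_form_orthonormal lg.
rewrite ltNge; apply/negP => q1; set w := row _ P in neg.
have : bil (bk_tensor a b q v) w w < 0 by rewrite neg ltrN10.
rewrite bil_bk_tensorE// pmulr_rlt0// ltNge => /negP; apply.
apply: addr_ge0; first exact: sqr_ge0.
rewrite -mulNr opprB; apply: mulr_ge0; first by rewrite subr_ge0.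
apply: addr_ge0; last exact: mulr_ge0 (le_trans ler01 q1) (sqr_ge0 _).
rewrite subr_ge0.
have [CS _] := lorentz_reverse_CS sa la w A.
by rewrite ler_pdivrMr// expr_div_n mulrAC ler_pdivlMr ?exprn_gt0// expr2 mulrA
  ler_pM2r// mulrC.
Qed.

(** The bound on [s^2] used for sufficiency is attained in the plane of [v] and the dual vector of
    [b], so testing [g] there gives the exact condition. *)
Lemma lorentzian_bk_tensor_gt0 q v : bk_domain a b v ->
  lorentzian_form (bk_tensor a b q v) ->
  0 < (1 + q) * dot b v ^+ 2 - q * conorm * bil a v v.
Proof.
move=> dv lg; have q1 := lorentzian_bk_tensor_lt1 dv lg.
have [A B] := dv; have L := bk_gt0 q dv.
have A0 := lt0r_neq0 A; have B2 : 0 < dot b v ^+ 2 by rewrite exprn_even_gt0.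
pose X := dot b v ^+ 2 - bil a v v * conorm.
have -> : (1 + q) * dot b v ^+ 2 - q * conorm * bil a v v = dot b v ^+ 2 + q * X.
  by rewrite /X; ring.
have : 0 <= X by rewrite subr_ge0 conorm_le.
rewrite le_eqVlt => /predU1P[<-|X0]; first by rewrite mulr0 addr0.
(* The coefficient of [v] is the one that makes [w] [g]-orthogonal to [v]. *)
pose w := bil a v v *: N - ((1 - q) * dot b v + q * bil a v v * conorm / dot b v) *: v.
have vw : bil a v w = q * bil a v v * (dot b v - bil a v v * conorm / dot b v).
  by rewrite /w !bilE bil_dual; ring.
have bw : dot b w = (q - 1) * X.
  by rewrite /w -bil_dual !bilE !(bil_dual, bilC N _ sa) dot_dual /X; field.
have w0 : w != 0.
  apply: contraTneq X0 => w0; move: bw; rewrite w0 /dot mul0mx mxE.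
  move/esym/eqP; rewrite mulf_eq0 subr_eq0 (lt_eqF q1) /= => /eqP ->.
  by rewrite ltxx.
have gvv : 0 < bil (bk_tensor a b q v) v v.
  by rewrite bil_bk_tensor_radial// !divff// !mulr1 subrK mulr1.
have gvw : bil (bk_tensor a b q v) v w = 0.
  by rewrite bil_bk_tensor_radial// vw bw /X; field; rewrite B A0.
have := lorentz_orth lg gvv gvw w0.
rewrite bil_bk_tensorE// pmulr_rlt0//.
have -> : bil a v w / bil a v v = q * X / dot b v.
  by rewrite vw /X; field; rewrite A0 B.
have -> : dot b w / dot b v - q * X / dot b v = - X / dot b v.
  by rewrite bw; field.
have -> : (q * X / dot b v) ^+ 2 - bil a w w / bil a v v = X.
  rewrite /w !bilE (bilC N v sa) !bil_dual dot_dual /X.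
  by field; rewrite A0 B.
have -> : q * X / dot b v + q * (- X / dot b v) = 0 by ring.
rewrite expr0n /= sub0r oppr_lt0 pmulr_rgt0 ?subr_gt0//.
have -> : X + q * (- X / dot b v) ^+ 2 = X / dot b v ^+ 2 * (dot b v ^+ 2 + q * X).
  by field.
by rewrite pmulr_rgt0// divr_gt0.
Qed.

(** The kernel vector [w] is, up to the factor [A], the test vector of [lorentzian_bk_tensor_gt0]
    for [q = -1] and [<b, b> = 0]. *)
Lemma bk_tensor_degenerate v : bk_domain a b v -> conorm = 0 ->
  bk_tensor a b (-1) v \notin unitmx.
Proof.
move=> dv N0; have [A B] := dv; have A0 := lt0r_neq0 A.
pose w := N - (2 * dot b v / bil a v v) *: v.
have w0 : w != 0.
  apply/eqP => w0; have : dot b w = 0 by rewrite w0 /dot mul0mx mxE.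
  rewrite -bil_dual /w !bilE conormE bil_dual N0 => /eqP.
  by rewrite sub0r oppr_eq0 !mulf_eq0 (negbTE B) invr_eq0 (negbTE A0) pnatr_eq0.
apply: contra w0 => ug; apply/eqP.
suff : w *m bk_tensor a b (-1) v = 0.
  move/(congr1 (mulmx^~ (invmx (bk_tensor a b (-1) v)))).
  by rewrite mulmxK// mul0mx.
apply/rowP => j; rewrite [RHS]mxE.
have -> : (w *m bk_tensor a b (-1) v) 0 j = bil (bk_tensor a b (-1) v) w (delta_mx 0 j).
  by rewrite /bil trmx_delta -colE [RHS]mxE.
rewrite bil_bk_tensor//.
have -> : bil a w (delta_mx 0 j) = dot b (delta_mx 0 j) -
    2 * dot b v / bil a v v * bil a v (delta_mx 0 j).
  by rewrite /w !bilE (bilC N _ sa) bil_dual; ring.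
have -> : bil a v w = - dot b v by rewrite /w !bilE bil_dual; field.
have -> : dot b w = - 2 * dot b v ^+ 2 / bil a v v.
  by rewrite -bil_dual /w !bilE conormE bil_dual N0; field.
by field; rewrite A0 B.
Qed.
End BKSignature.

(** * Topology of the tangent bundle *)

Section TangentBundle.
Context {R : realType} {n : nat} (M : manifold R n).
Implicit Types (x : M) (W : set (tangent_bundle M)).

Lemma tangent_openP W : open W <-> tangent_open W.
Proof. by []. Qed.

Lemma chart_at_img x : chart_img (chart_at x) (chart_at x x).
Proof. by exists x => //; exact: chart_at_dom. Qed.

(** The preferred chart in [chart_frame] changes with the point; at the center it is the chart
    itself, and the transition map is the identity nearby. *)
Lemma chart_frame_center x : chart_frame (chart_at x) (chart_at x x) = 1%:M.
Proof.
have xd := chart_at_dom x; set c := chart_at x in xd *.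
rewrite /chart_frame chart_mapK// -/c.
have near_id : {near (c x : 'rV[R]_n), id =1 transition c c}.
  apply: (open_near_eq (@chart_img_open _ _ _ c)) (chart_at_img x).
  by move=> _ [y dy <-]; rewrite /transition /= chart_mapK.
have dtr : differentiable (transition c c) (c x : 'rV[R]_n).
  by apply: (near_eq_differentiable near_id); exact: ex_diff.
apply/row_matrixP => i; rewrite rowE /jacobian mul_rV_lin1 -deriveE// row1.
by rewrite -(near_eq_derive _ near_id) derive_id.
Qed.

Lemma tangent_param_center x v :
  tangent_param (chart_at x) (chart_at x x : 'rV[R]_n, v) = Tangent x v.
Proof.
rewrite /tangent_param /= chart_frame_center mulmx1 chart_mapK//.
exact: chart_at_dom.
Qed.

Lemma nbhs_pair_preimage (T U V : topologicalType) (f : T -> U) (v : V) (t : T)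
    (A : set (U * V)) : {for t, continuous f} -> open A -> A (f t, v) ->
  nbhs t [set y | A (f y, v)].
Proof.
move=> cf oA At.
have cfv : (f y, v) @[y --> t] --> (f t, v).
  exact: (@cvg_pair _ _ _ (nbhs t) (nbhs (f t)) (nbhs v) _ _ _
    f (fun=> v) cf (cvg_cst _)).
exact: cfv (open_nbhs_nbhs (conj oA At)).
Qed.

Lemma continuous_pairr (U V : topologicalType) (u : U) :
  continuous (fun v : V => (u, v)).
Proof.
move=> v; exact: (@cvg_pair _ _ _ (nbhs v) (nbhs u) (nbhs v) _ _ _
  (fun=> u) id (cvg_cst _) cvg_id).
Qed.

Lemma open_fiber W x : open W -> open (fiber W x).
Proof.
move=> /tangent_openP/(_ _ (chart_at_atlas x)) oW.
pose f v : 'rV[R]_n * 'rV[R]_n := (chart_at x x, v).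
have -> : fiber W x = f @^-1` in_chart (chart_at x) W.
  apply/seteqP; split => v; rewrite /in_chart /= tangent_param_center.
    by split=> //; exact: chart_at_img.
  by case.
by apply: open_comp => // v _; exact: continuous_pairr.
Qed.

(** The components of [v] in the chart at [x] are kept fixed while the base point moves. *)
Lemma nbhs_base W x v : open W -> W (Tangent x v) ->
  nbhs x (@base R n M @` W).
Proof.
move=> oW Wxv; have xd := chart_at_dom x.
have oc := (tangent_openP W).1 oW _ (chart_at_atlas x).
have Wc : in_chart (chart_at x) W (chart_at x x, v).
  by split; [exact: chart_at_img|rewrite tangent_param_center].
have nf := nbhs_pair_preimage (chart_map_continuous xd) oc Wc.
apply: filterS (filterI (open_nbhs_nbhs (conj (@chart_dom_open _ _ _ (chart_at x)) xd)) nf).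
move=> y [dy [_ Wy]].
exists (tangent_param (chart_at x) (chart_at x y, v)); first exact: Wy.
exact: chart_mapK.
Qed.

Lemma open_base W : open W -> open (@base R n M @` W).
Proof.
by move=> oW; rewrite openE => _ [[x v] Wxv <-]; exact: nbhs_base Wxv.
Qed.

Lemma continuous_Tangent x : continuous (@Tangent R n M x).
Proof. by apply/continuousP => W oW; exact: open_fiber. Qed.

(** A relatively clopen [B] contains or misses each fiber of [W], so [B] and its complement in [W]
    have disjoint open projections covering [M]. *)
Lemma connected_bundle W : connected [set: M] -> open W ->
  (forall x, fiber W x !=set0) -> (forall x, connected (fiber W x)) ->
  connected W.
Proof.
move=> cM oW W0 cW B B0 [C oC BC] [D cD BD].
have fib x : fiber W x `<=` fiber B x \/ fiber B x = set0.
  have [[v Bv]|/set0P/negP/negPn/eqP] := pselect (fiber B x !=set0); last by right.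
  left; have <- : fiber B x = fiber W x; last by [].
  apply: (cW x); first by exists v.
    exists (fiber C x); first exact: open_fiber.
    by rewrite /fiber BC.
  exists (fiber D x); last by rewrite /fiber BD.
  by move/continuous_closedP : (@continuous_Tangent x); apply.
have oB : open B by rewrite BC; exact: openI.
have oWB : open (W `\` B).
  rewrite BD setDE setCI setIUr setICr set0U; apply: openI => //.
  exact: closed_openC.
have baseB : @base R n M @` B = [set: M].
  apply: cM; first by case: B0 => w Bw; exists (base w), w.
    by exists (@base R n M @` B); [exact: open_base|rewrite setTI].
  exists (@base R n M @` B); last by rewrite setTI.
  rewrite -openC (_ : ~` _ = @base R n M @` (W `\` B)); first exact: open_base.
  apply/seteqP; split => [x nx|_ [[x v] [Wv nBv] <-] [[y w] Bw /= yx]].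
    have [v Wv] := W0 x; exists (Tangent x v) => //; split=> // Bv.
    by apply: nx; exists (Tangent x v).
  rewrite {}yx in Bw; have [sub|B_0] := fib x; first exact/nBv/sub.
  by have : fiber B x w := Bw; rewrite B_0.
apply/seteqP; split => [w|[x v] Wv]; first by rewrite BC => -[].
have [[y w] Bw /= yx] : (@base R n M @` B) x by rewrite baseB.
rewrite yx in Bw; have [sub|B_0] := fib x; first exact: sub.
by have : fiber B x w := Bw; rewrite B_0.
Qed.
End TangentBundle.

(** * Extension by zero and connectedness *)

Section Components.
Context {R : realType}.

(* The restriction of [f] to [C] does not vanish, so its extension by [0] to the
   boundary of [U] forbids boundary points of [U] inside [C]. *)
Lemma extends_by_0_eq n (C U : set 'rV[R]_n) (f : 'rV[R]_n -> R) :
  connected C -> open U -> U !=set0 -> U `<=` C ->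
  {in C, continuous f} -> (forall v, C v -> f v != 0) ->
  extends_by_0 U f -> U = C.
Proof.
move=> cC oU U0 UC cf f0 [h [ch hf hb]].
apply: cC => //.
  by exists U => //; apply/seteqP; split => [v Uv|v []//]; split => //; exact: UC.
exists (closure U); first exact: closed_closure.
apply/seteqP; split => v; first by move=> Uv; split; [exact: UC|exact: subset_closure].
move=> [Cv clv]; apply: contrapT => nUv.
have hv : h v = 0 by apply: hb; split => // /interior_subset.
have PF : ProperFilter (within U (nbhs v)).
  by apply: within_nbhs_proper.
have fv : f @ within U (nbhs v) --> f v.
  by apply: cvg_within_filter; apply: cf; rewrite inE.
have hv' : h @ within U (nbhs v) --> h v.
  move/subspace_continuousP: ch => /(_ v clv) ch P hP.
  have {}hP : nbhs v [set u | closure U u -> P (h u)] := ch P hP.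
  have : nbhs v [set u | U u -> P (h u)].
    by apply: filterS hP => u + Uu; apply; exact: subset_closure.
  exact.
have : f v = h v.
  apply: (cvg_unique (@norm_hausdorff _ _) fv); apply: (cvg_trans _ hv').
  apply: near_eq_cvg.
  have : nbhs v [set u | U u -> h u = f u] by apply: filterE => u; exact: hf.
  exact.
by rewrite hv; exact/eqP/f0.
Qed.

Lemma continuous_squeeze0 (V : normedModType R) (C : set V) (f g h : V -> R) :
  open C -> {in C, continuous f} -> continuous g ->
  (forall v, C v -> h v = f v) -> (forall v, ~ C v -> h v = 0) ->
  (forall v, C v -> 0 <= f v <= g v) ->
  (forall v, closure C v -> ~ C v -> g v = 0) -> continuous h.
Proof.
move=> oC cf cg hC hN fg g0 v.
have [Cv|nCv] := pselect (C v).
  have fh : \near v, f v = h v.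
    by apply: filterS (open_nbhs_nbhs (conj oC Cv)) => u Cu; rewrite /= hC.
  rewrite /continuous_at hC//; apply: cvg_trans (cf v (mem_set Cv)).
  exact: near_eq_cvg fh.
have [clv|nclv] := pselect (closure C v); last first.
  have oclC : open (~` closure C) by exact/closed_openC/closed_closure.
  have h0 : \forall u \near v, h u = 0.
    apply: filterS (open_nbhs_nbhs (conj oclC nclv)) => u ncu /=.
    by apply: hN => Cu; apply: ncu; exact: subset_closure.
  by rewrite /continuous_at hN//; exact: cvg_near_cst h0.
rewrite /continuous_at hN//; apply/cvgrPdist_lt => e e0.
have /cvgrPdist_lt/(_ e e0) := cg v; rewrite g0//.
apply: filterS => u; rewrite !sub0r !normrN => gu.
have [Cu|nCu] := pselect (C u); last by rewrite hN// normr0.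
rewrite hC//; have /andP[f0 fgu] := fg u Cu.
by rewrite ger0_norm//; apply: le_lt_trans fgu (le_lt_trans (ler_norm _) gu).
Qed.

(** Reduces the boundary condition to finding a continuous majorant that vanishes on the boundary;
    [f] is extended by [0] to the whole space. *)
Lemma extends_by_0_squeeze n (C : set 'rV[R]_n) (f g : 'rV[R]_n -> R) :
  open C -> {in C, continuous f} -> continuous g ->
  (forall v, C v -> 0 <= f v <= g v) ->
  (forall v, closure C v -> ~ C v -> g v = 0) -> extends_by_0 C f.
Proof.
move=> oC cf cg fg g0.
pose h v := if pselect (C v) is left _ then f v else 0.
have hC v : C v -> h v = f v by rewrite /h; case: pselect.
have hN v : ~ C v -> h v = 0 by rewrite /h; case: pselect.
exists h; split => //; last first.
  by move=> v [_ +]; rewrite (interior_id _).1//; exact: hN.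
exact/continuous_subspaceT/(continuous_squeeze0 oC cf cg hC hN fg g0).
Qed.
End Components.

(** * Timelike cones *)

Section Convex.
Context {R : realType}.

Lemma convex_connected (V : normedModType R) (C : set V) :
  (forall u v (t : R), C u -> C v -> 0 <= t <= 1 -> C (u + t *: (v - u))) ->
  connected C.
Proof.
move=> cvxC; have [[u Cu]|/set0P/negP/negPn/eqP->] := pselect (C !=set0); last exact: connected0.
pose seg v := (fun t : R => u + t *: (v - u)) @` `[0, 1].
have segu v : seg v u.
  by exists 0; rewrite /= ?in_itv /= ?lexx ?ler01// scale0r addr0.
have -> : C = \bigcup_(v in C) seg v.
  apply/seteqP; split => [v Cv|v [w Cw [t /= t01 <-]]].
    by exists v => //; exists 1; rewrite /= ?in_itv /= ?lexx ?ler01// scale1r addrC subrK.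
  by apply: cvxC => //; move: t01; rewrite in_itv.
apply: bigcup_connected; first by exists u => v _; exact: segu.
move=> v _; apply: connected_continuous_connected; first exact: segment_connected.
apply: continuous_subspaceT => t; apply: cvgD; first exact: cvg_cst.
by apply: cvgZl; exact: cvg_id.
Qed.

(** The absolute value gives continuity across [0], so that majorants of [L] are defined and
    continuous on the whole tangent space. *)
Lemma continuous_powR_norm (r : R) : 0 < r -> continuous (fun x : R => `|x| `^ r).
Proof.
move=> r0 x; have [->|x0] := eqVneq x 0.
  rewrite /continuous_at normr0 powR0 ?gt_eqF//; apply/cvgrPdist_lt => e e0.
  apply/nbhs_ballP; exists (e `^ r^-1); first by rewrite /= powR_gt0.
  move=> y; rewrite /ball /= !sub0r !normrN => ye.
  rewrite ger0_norm ?powR_ge0//.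
  have -> : e = (e `^ r^-1) `^ r by rewrite -powRrM mulVf ?gt_eqF// powRr1// ltW.
  by apply: gt0_ltr_powR => //; rewrite nnegrE ?powR_ge0.
apply: (@continuous_comp _ _ _ (fun x : R => `|x|) (fun y => y `^ r)).
  exact: norm_continuous.
apply: differentiable_continuous; apply/derivable1_diffP.
by apply: derivable_powR; rewrite in_itv /= andbT normr_gt0.
Qed.
Lemma open_gt0 (V : topologicalType) (f : V -> R) :
  continuous f -> open [set u | 0 < f u].
Proof.
move=> cf; apply: (@open_comp _ _ f [set x | 0 < x]); last exact: open_gt.
by move=> u _; exact: cf.
Qed.

Lemma closed_ge0 (V : topologicalType) (f : V -> R) :
  continuous f -> closed [set u | 0 <= f u].
Proof.
move=> cf; apply: (@closed_comp _ _ f [set x | 0 <= x]); last exact: closed_ge.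
by move=> u _; exact: cf.
Qed.

End Convex.

Section Cones.
Context {R : realType} {n : nat}.
Variables (a : 'M[R]_n.+2) (b : 'rV[R]_n.+2).
Hypotheses (sa : a^T = a) (la : lorentzian_form a).
Implicit Types (t u v w : 'rV[R]_n.+2).

Definition timecone t : set 'rV[R]_n.+2 :=
  [set u | 0 < bil a u u /\ 0 < bil a t u].

Lemma open_timecone t : open (timecone t).
Proof.
by apply: openI; apply: open_gt0; [exact: continuous_quad|exact: continuous_bilr].
Qed.

Lemma timecone_bil t u v : 0 < bil a t t -> timecone t u -> timecone t v ->
  0 < bil a u v.
Proof. by move=> tt [uu tu] [vv tv]; exact: (lorentz_same_cone sa la tt uu (ltW vv)). Qed.

Lemma timecone_comb t u v (k l : R) : 0 < bil a t t -> timecone t u ->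
  timecone t v -> 0 < k -> 0 <= l -> timecone t (k *: u + l *: v).
Proof.
move=> tt Cu Cv k0 l0; have uv := timecone_bil tt Cu Cv.
have [uu tu] := Cu; have [vv tv] := Cv; split.
  rewrite !bilE (bilC v u sa).
  rewrite [ltRHS](_ : _ = k ^+ 2 * bil a u u +
    (2 * (k * (l * bil a u v)) + l ^+ 2 * bil a v v)); last by ring.
  apply: ltr_pwDl; first by rewrite mulr_gt0 ?exprn_gt0.
  by rewrite addr_ge0// mulr_ge0// ?sqr_ge0 ?(ltW vv)// mulr_ge0 ?(ltW k0)// mulr_ge0 ?(ltW uv).
by rewrite !bilE ltr_pwDl ?mulr_gt0// mulr_ge0// ltW.
Qed.

Lemma timecone_convex t u v (k : R) : 0 < bil a t t -> timecone t u ->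
  timecone t v -> 0 <= k <= 1 -> timecone t (u + k *: (v - u)).
Proof.
move=> tt Cu Cv /andP[k0 k1].
have -> : u + k *: (v - u) = (1 - k) *: u + k *: v.
  by rewrite scalerBr scalerBl scale1r addrA addrAC.
move: k1; rewrite le_eqVlt => /predU1P[->|k1].
  by rewrite subrr scale0r add0r scale1r.
by apply: timecone_comb => //; rewrite subr_gt0.
Qed.

(** The cone is convex, hence inside the component; conversely [a(t, .)] has no zero among timelike
    vectors, so its sign is constant on the component. *)
Lemma timecone_component t : 0 < bil a t t ->
  connected_component [set u | 0 < bil a u u] t = timecone t.
Proof.
move=> tt; have Ct : timecone t t by [].
apply/seteqP; split; last first.
  apply: connected_component_max => // [u [] //|].
  by apply: convex_connected => u v k *; exact: timecone_convex.
set K := connected_component _ t.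
have Kpos : K `<=` [set u | 0 < bil a u u] := @connected_component_sub _ _ _.
suff <- : K `&` [set u | 0 < bil a t u] = K by move=> u [/Kpos].
apply: (@component_connected _ [set u | 0 < bil a u u] t).
- by exists t; split => //; exact: connected_component_refl.
- by exists [set u | 0 < bil a t u] => //; apply: open_gt0; exact: continuous_bilr.
- exists [set u | 0 <= bil a t u]; first by apply: closed_ge0; exact: continuous_bilr.
  apply/seteqP; split => u [Ku /= tu]; split => //=; first exact: ltW.
  rewrite lt_neqAle tu andbT eq_sym; apply: (lorentz_causal_neq0 la) => //.
    exact/ltW/Kpos.
  by apply: contraTneq (Kpos _ Ku) => ->; rewrite /= bil0l ltxx.
Qed.

Lemma closure_timecone t u : 0 < bil a t t -> closure (timecone t) u ->
  ~ timecone t u -> bil a u u = 0.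
Proof.
move=> tt clu nu.
have uu : 0 <= bil a u u.
  have := closure_subset (_ : timecone t `<=` [set u | 0 <= bil a u u]).
  move=> /(_ _ _ clu); rewrite -(closure_id _).1; last exact/closed_ge0/continuous_quad.
  by apply => v [/ltW].
have tu : 0 <= bil a t u.
  have := closure_subset (_ : timecone t `<=` [set u | 0 <= bil a t u]).
  move=> /(_ _ _ clu); rewrite -(closure_id _).1; last exact/closed_ge0/continuous_bilr.
  by apply => v [_ /ltW].
apply/eqP/negPn/negP => u0; apply: nu.
have uu' : 0 < bil a u u by rewrite lt_neqAle eq_sym u0.
split=> //; rewrite lt_neqAle tu andbT eq_sym.
by apply: (lorentz_causal_neq0 la) => //; apply: contraNneq u0 => ->; rewrite bil0l.
Qed.

Lemma causal_dot_neq0 u : 0 <= conorm a b -> b != 0 -> 0 < bil a u u -> dot b u != 0.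
Proof.
move=> c0 b0 uu; rewrite -(bil_dual b sa la).
by apply: (lorentz_causal_neq0 la); rewrite ?conormE// dual_vec_eq0.
Qed.

Lemma causal_dot_cone_bound t u : 0 <= conorm a b -> b != 0 -> 0 < bil a t t ->
  timecone t u -> bil a u u * `|dot b t| <= 2 * bil a t u * `|dot b u|.
Proof.
move=> c0 b0 tt [uu tu].
(* The sign puts [s *: N] in the causal cone of [u], so that [lorentz_cone_bound] applies with [u]
   as reference vector. *)
pose N := dual_vec a b; pose s : R := Num.sg (dot b u).
have bu0 := causal_dot_neq0 c0 b0 uu.
have bN v : dot b v = bil a v N by rewrite bil_dual.
have ss : s ^+ 2 = 1 by rewrite sqr_sg bu0.
have NN : 0 <= bil a (s *: N) (s *: N).
  by rewrite !bilE mulrA -expr2 ss mul1r /N conormE.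
have uN : bil a u (s *: N) = `|dot b u| by rewrite bilZr -bN normrEsg.
have ut : 0 < bil a u t by rewrite bilC.
have upos : 0 < bil a u (s *: N) by rewrite uN normr_gt0.
have := lorentz_cone_bound sa la uu tt NN ut upos.
have tpos := lorentz_same_cone sa la uu tt NN ut upos.
rewrite uN (bilC u t sa) => h; apply: ltW; apply: le_lt_trans h.
rewrite ler_pM2l// -(gtr0_norm tpos) bilZr -bN normrM.
by rewrite -[X in X <= _]mul1r -ss normr_sg bu0 ss.
Qed.

Lemma near_null t (d : R) : 0 <= conorm a b -> b != 0 -> 0 < bil a t t -> 0 < d ->
  exists2 u, timecone t u & bil a u u < d * dot b u ^+ 2.
Proof.
move=> c0 b0 tt d0.
have [P [uP e0 ei eij]] := lorentzian_form_orthonormal la.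
(* Unlike [Num.sg] this is [1] at [0], so its square is always [1], even when [b] vanishes on the
   spatial vector used below. *)
pose sg (x : R) : R := if 0 <= x then 1 else -1.
have sg1 x : sg x ^+ 2 = 1 by rewrite /sg; case: ifP => _; rewrite ?sqrrN expr1n.
have sgx x : 0 <= sg x * x.
  rewrite /sg; case: (leP 0 x) => x0; first by rewrite /= mul1r.
  by rewrite /= mulN1r oppr_ge0 ltW.
pose v := sg (bil a t (row 0 P)) *: row 0 P.
have vv : bil a v v = 1 by rewrite !bilE e0 mulr1 -expr2 sg1.
have tv : 0 < bil a t v.
  rewrite lt_neqAle bilZr sgx andbT -bilZr eq_sym.
  apply: (lorentz_causal_neq0 la) => //; first by rewrite vv ler01.
  by apply/eqP => v0; move: vv; rewrite /v v0 bil0l => /esym/eqP; rewrite oner_eq0.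
pose e := sg (dot b v * dot b (row (lift 0 0) P)) *: row (lift 0 0) P.
have ee : bil a e e = -1 by rewrite !bilE ei// mulrA -expr2 sg1 mul1r.
have ve : bil a v e = 0 by rewrite /v /e !bilE eij// !mulr0.
have bve : 0 <= dot b v * dot b e by rewrite /e dotZ mulrCA sgx.
clearbody e; clearbody v.
have bv : 0 < dot b v ^+ 2.
  by rewrite exprn_even_gt0//=; apply: causal_dot_neq0; rewrite ?vv.
(* The vector [v + e] is null. Shortening [e] by the factor [1 - ep] gives
   [A = ep (2 - ep) <= d b(v)^2 / 2], while [B^2 >= b(v)^2] by the choice of the sign of [e]. *)
pose ep := Num.min 1 (d * dot b v ^+ 2 / 4).
have ep0 : 0 < ep by rewrite lt_min ltr01 /= divr_gt0// mulr_gt0.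
have ep1 : ep <= 1 by rewrite ge_min lexx.
have ep2 : ep <= d * dot b v ^+ 2 / 4 by rewrite ge_min lexx orbT.
pose u := v + (1 - ep) *: e.
have uu : bil a u u = ep * (2 - ep).
  by rewrite /u !bilE (bilC e v sa) ve ee vv; ring.
have vu : bil a v u = 1 by rewrite /u !bilE ve vv; ring.
have uupos : 0 < bil a u u by rewrite uu mulr_gt0// subr_gt0 (le_lt_trans ep1) ?ltr1n.
exists u.
  split=> //; apply: (lorentz_same_cone sa la (v := v)) => //.
  - by rewrite vv.
  - exact: ltW.
  - by rewrite bilC.
  - by rewrite vu.
have bu : dot b v ^+ 2 <= dot b u ^+ 2.
  rewrite /u dotD dotZ -subr_ge0.
  have -> : (dot b v + (1 - ep) * dot b e) ^+ 2 - dot b v ^+ 2 =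
    2 * (1 - ep) * (dot b v * dot b e) + ((1 - ep) * dot b e) ^+ 2 by ring.
  by rewrite addr_ge0 ?sqr_ge0// mulr_ge0// mulr_ge0// subr_ge0.
apply: lt_le_trans (_ : d * dot b v ^+ 2 <= _); last by rewrite ler_pM2l.
rewrite uu; nra.
Qed.

Lemma spacelike_near_kernel t (d s : R) : conorm a b < 0 -> 0 < bil a t t -> 0 < d ->
  s != 0 ->
  exists u, [/\ timecone t u, 0 < s * dot b u & dot b u ^+ 2 < d * bil a u u].
Proof.
move=> c0 tt d0 s0; pose N := dual_vec a b; pose c := conorm a b.
have bN v : bil a v N = dot b v by rewrite bil_dual.
have bNN : dot b N = c by [].
(* The projection of [t] to the kernel of [b]. It stays in the open cone because [c < 0], so a small
   move along [- s *: N] keeps it there and makes [s B] positive. *)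
pose v := t - (dot b t / c) *: N.
have bv : dot b v = 0.
  by rewrite -bN /v !bilE !bN bNN; field; rewrite lt_eqF.
have av : bil a v v = bil a t t - dot b t ^+ 2 / c.
  by rewrite /v !bilE (bilC N t sa) !bN bNN; field; rewrite lt_eqF.
have tv : bil a t v = bil a t t - dot b t ^+ 2 / c.
  by rewrite /v !bilE !bN; ring.
have pos : 0 < bil a t t - dot b t ^+ 2 / c.
  by rewrite ltr_pwDl// oppr_ge0 mulr_ge0_le0 ?sqr_ge0// invr_le0 ltW.
pose U := timecone t `&` [set u | 0 < d * bil a u u - dot b u * dot b u].
have oU : open U.
  apply: openI; first exact: open_timecone.
  apply: open_gt0 => u.
  exact: (cvgB (cvgM (cvg_cst d) (@continuous_quad _ _ a u))
    (cvgM (@continuous_dot _ _ b u) (@continuous_dot _ _ b u))).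
have Uv : U v.
  by split; [split; rewrite ?av ?tv|rewrite /= bv mulr0 subr0 mulr_gt0// av].
pose f (e : R) := v + e *: (- s *: N).
have cf : f @ (0 : R) --> v.
  have vE : v = v + 0 *: (- s *: N) by rewrite scale0r addr0.
  rewrite [X in _ --> X]vE.
  apply: cvgD; first exact: cvg_cst.
  by apply: cvgZl; exact: cvg_id.
have /nbhs_ballP[r /= r0 rU] := cf _ (open_nbhs_nbhs (conj oU Uv)).
have [Cu /=] : U (f (r / 2)).
  by apply: rU; rewrite /ball /= sub0r normrN gtr0_norm ?divr_gt0// ltr_pdivrMr// ltr_pMr ?ltr1n.
rewrite subr_gt0 -expr2 => du; exists (f (r / 2)); split => //.
rewrite /f dotD !dotZ bv bNN add0r.
have -> : s * (r / 2 * (- s * c)) = r / 2 * (s ^+ 2 * - c) by ring.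
by rewrite mulr_gt0 ?divr_gt0// mulr_gt0 ?oppr_gt0// exprn_even_gt0.
Qed.
End Cones.

(** * Extension by zero *)

Section Extension.
Context {R : realType}.

Lemma continuous_powR_normM (V : topologicalType) (f g : V -> R) (r s : R) :
  0 < r -> 0 < s -> continuous f -> continuous g ->
  continuous (fun u => `|f u| `^ r * `|g u| `^ s).
Proof.
move=> r0 s0 cf cg u; apply: cvgM.
  exact: (@continuous_comp _ _ _ f (fun x : R => `|x| `^ r) u (cf u)
    (@continuous_powR_norm R r r0 _)).
exact: (@continuous_comp _ _ _ g (fun x : R => `|x| `^ s) u (cg u)
  (@continuous_powR_norm R s s0 _)).
Qed.

Context {n : nat}.
Variables (a : 'M[R]_n.+2) (b : 'rV[R]_n.+2) (q : R).
Hypotheses (sa : a^T = a) (la : lorentzian_form a).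
Implicit Types (t u v w : 'rV[R]_n.+2).

Lemma powR_mul_div (x y r : R) : 0 < x -> 0 < y ->
  x * (y / x) `^ r = x `^ (1 - r) * y `^ r.
Proof.
move=> x0 y0; rewrite /powR !gt_eqF ?divr_gt0// ln_div//.
by rewrite -{1}[x]lnK// -!expRD; congr expR; ring.
Qed.

Lemma powR_invN (x r : R) : 0 < x -> x^-1 `^ (- r) = x `^ r.
Proof. by move=> x0; rewrite /powR !gt_eqF ?invr_gt0// lnV// mulrNN. Qed.

Lemma bkE u : bk_domain a b u ->
  bk a b q u = bil a u u `^ (1 - q) * (dot b u ^+ 2) `^ q.
Proof. by move=> [A B]; rewrite /bk powR_mul_div// exprn_even_gt0. Qed.

Lemma bk_continuous u : bk_domain a b u -> {for u, continuous (bk a b q)}.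
Proof.
move=> du; apply: (Ck_continuous (k := 0) (U := bk_domain a b)) => //.
apply: (@Ck_bk R n.+2 _ 0 (bk_domain a b) (cst a) (cst b) (fun u => u) q) => //.
- exact: open_bk_domain.
- exact: Ck_cst.
- exact: Ck_cst.
- exact: Ck_id.
Qed.

Lemma bk_extends_by_0 (C : set 'rV[R]_n.+2) (g : 'rV[R]_n.+2 -> R) :
  open C -> C `<=` bk_domain a b -> continuous g ->
  (forall u, C u -> bk a b q u <= g u) ->
  (forall u, closure C u -> ~ C u -> g u = 0) -> extends_by_0 C (bk a b q).
Proof.
move=> oC CD cg bkg g0; apply: (extends_by_0_squeeze oC _ cg) => //.
  by move=> u; rewrite inE => Cu; exact/bk_continuous/CD.
by move=> u Cu; rewrite bkg// ltW// bk_gt0//; exact: CD.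
Qed.

(** Both exponents in [A^(1 - q) (B^2)^q] are positive, so [L] with absolute values inserted is its
    own majorant. *)
Lemma bk_extends_pos (C : set 'rV[R]_n.+2) : 0 < q < 1 -> open C ->
  C `<=` bk_domain a b ->
  (forall u, closure C u -> ~ C u -> bil a u u = 0 \/ dot b u = 0) ->
  extends_by_0 C (bk a b q).
Proof.
move=> /andP[q0 q1] oC CD bd.
have q1' : 0 < 1 - q by rewrite subr_gt0.
have cB2 : continuous (fun u => dot b u * dot b u).
  by move=> u; exact: (cvgM (@continuous_dot _ _ b u) (@continuous_dot _ _ b u)).
have cg := continuous_powR_normM q1' q0 (@continuous_quad _ _ a) cB2.
apply: (bk_extends_by_0 oC CD cg) => u Cu.
  have [A B] := CD u Cu; rewrite bkE; last by split.
  by rewrite -expr2 gtr0_norm// ger0_norm// sqr_ge0.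
move=> /(bd u Cu)[]->; first by rewrite normr0 powR0 ?gt_eqF// mul0r.
by rewrite mul0r normr0 [_ `^ q]powR0 ?gt_eqF// mulr0.
Qed.

Lemma bk_extends_neg t : -1 < q < 0 -> 0 <= conorm a b -> b != 0 ->
  0 < bil a t t -> extends_by_0 (timecone a t) (bk a b q).
Proof.
move=> /andP[q1 q0] c0 b0 tt.
have CD : timecone a t `<=` bk_domain a b.
  by move=> u [uu tu]; split => //; exact: (causal_dot_neq0 sa la).
have r0 : 0 < 1 + q by rewrite -ltrBlDl sub0r.
have s0 : 0 < - q by rewrite oppr_gt0.
have bt := causal_dot_neq0 sa la c0 b0 tt.
(* [causal_dot_cone_bound] says [A <= D |B|], so [L = A (A / B^2)^(-q)] is at most
   [A (D^2 / A)^(-q) = A^(1 + q) (D^2)^(-q)], where both exponents are positive. *)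
pose D u := 2 / `|dot b t| * bil a t u.
have cD : continuous D.
  by move=> u; exact: (cvgM (cvg_cst (2 / `|dot b t|)) (@continuous_bilr _ _ a t u)).
have cD2 : continuous (fun u => D u * D u).
  by move=> u; exact: (cvgM (cD u) (cD u)).
have cg := continuous_powR_normM r0 s0 (@continuous_quad _ _ a) cD2.
apply: (bk_extends_by_0 (@open_timecone _ _ a t) CD cg) => u Cu.
  have [A B] := CD u Cu; have [_ tu] := Cu.
  have D0 : 0 < D u by rewrite mulr_gt0 ?divr_gt0 ?normr_gt0.
  have B2 : 0 < dot b u ^+ 2 by rewrite exprn_even_gt0.
  have le1 : bil a u u / dot b u ^+ 2 <= D u ^+ 2 / bil a u u.
    rewrite ler_pdivrMr// mulrAC ler_pdivlMr// -expr2 -(real_normK (num_real (dot b u))).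
    rewrite -exprMn ler_pXn2r ?nnegrE ?mulr_ge0 ?(ltW A) ?(ltW D0) ?(ltW tu)//.
    have -> : D u = 2 * bil a t u / `|dot b t| by rewrite /D mulrAC.
    rewrite mulrAC ler_pdivlMr ?normr_gt0//.
    exact: causal_dot_cone_bound.
  have -> : bk a b q u = bil a u u * (bil a u u / dot b u ^+ 2) `^ (- q).
    by rewrite -invf_div powR_invN ?divr_gt0.
  have le2 : (bil a u u / dot b u ^+ 2) `^ (- q) <= (D u ^+ 2 / bil a u u) `^ (- q).
    by apply: ge0_ler_powR le1; rewrite ?nnegrE ?divr_ge0 ?sqr_ge0// ltW.
  apply: le_trans (_ : bil a u u * (D u ^+ 2 / bil a u u) `^ (- q) <= _).
    by rewrite ler_pM2l.
  by rewrite powR_mul_div ?exprn_gt0// opprK gtr0_norm// -expr2 ger0_norm// sqr_ge0.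
by move=> /(closure_timecone la tt Cu) ->; rewrite normr0 powR0 ?gt_eqF// mul0r.
Qed.

Lemma bk_extends_kropina t : q = -1 -> 0 < conorm a b -> b != 0 ->
  0 < bil a t t -> extends_by_0 (timecone a t) (bk a b q).
Proof.
move=> q1 c0 b0 tt.
have CD : timecone a t `<=` bk_domain a b.
  by move=> u [uu tu]; split => //; exact: (causal_dot_neq0 sa la (ltW c0)).
have cg : continuous (fun u => bil a u u / conorm a b).
  by move=> u; exact: (cvgM (@continuous_quad _ _ a u) (cvg_cst _)).
apply: (bk_extends_by_0 (@open_timecone _ _ a t) CD cg) => u Cu.
  have [A B] := CD u Cu; have B2 : 0 < dot b u ^+ 2 by rewrite exprn_even_gt0.
  rewrite /bk q1 powR_inv1 ?divr_ge0 ?(ltW A) ?(ltW B2)// ler_pM2l//.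
  rewrite invf_div ler_pdivrMr// mulrC ler_pdivlMr//.
  exact: conorm_le.
by move=> /(closure_timecone la tt Cu) ->; rewrite mul0r.
Qed.
End Extension.

(** * Bogoslovsky-Kropina metrics on manifolds *)

Lemma open_Ck_gt0 (R : realType) (V : normedModType R) (U : set V) (f : V -> R) :
  open U -> Ck 0 U f -> open (U `&` [set u | 0 < f u]).
Proof.
move=> oU cf; rewrite openE => u [Uu fu]; rewrite /interior.
apply: filterI; first exact: open_nbhs_nbhs.
exact: cf u Uu _ (open_nbhs_nbhs (conj (@open_gt R 0) fu)).
Qed.

Lemma connected_gt0 (R : realType) (T : topologicalType) (K : set T) (f : T -> R) v :
  connected K -> continuous f -> (forall u, K u -> f u != 0) -> K v ->
  0 < f v -> forall u, K u -> 0 < f u.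
Proof.
move=> cK cf f0 Kv fv; suff <- : K `&` [set u | 0 < f u] = K by move=> u [].
apply: cK.
- by exists v.
- by exists [set u | 0 < f u] => //; exact: open_gt0.
- exists [set u | 0 <= f u]; first exact: closed_ge0.
  apply/seteqP; split => u [Ku /= fu]; split => //=; first exact: ltW.
  by rewrite lt_neqAle fu eq_sym f0.
Qed.

Section BogoslovskyKropina.
Context {R : realType} {n : nat} (M : manifold R n.+2).
Variables (a : M -> 'M[R]_n.+2) (b : M -> 'rV[R]_n.+2) (q : R).
Hypotheses (lor : lorentzian_metric a) (ofb : one_form b).
Implicit Types (x : M) (v : 'rV[R]_n.+2) (w : tangent_bundle M)
  (W T : set (tangent_bundle M)).

Local Notation L := (bk_function a b q).

Let sa x : (a x)^T = a x. Proof. by case: lor. Qed.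
Let la x : lorentzian_form (a x). Proof. by case: lor. Qed.

Definition regular : set (tangent_bundle M) :=
  [set w | bk_domain (a (base w)) (b (base w)) (vec w)].

Lemma regularE :
  [set w | quad a w != 0 /\ [set s | 0 < s] (ab_ratio a b w)] = regular.
Proof.
apply/seteqP; split => [[x v] [/= A0]|[x v] dv]; last first.
  have [A B] := dv; split; first exact: lt0r_neq0 A.
  exact: ratio_gt0 dv.
rewrite /ab_ratio => r0; have B : lin b (Tangent x v) != 0.
  by apply: contraTneq r0 => ->; rewrite expr0n mul0r ltxx.
split; last exact: B.
by move: r0; rewrite pmulr_rgt0 ?invr_gt0// exprn_even_gt0.
Qed.

Lemma fundamental_tensor_bk x v : regular (Tangent x v) ->
  fundamental_tensor L (Tangent x v) = bk_tensor (a x) (b x) q v.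
Proof.
move=> dv; apply/matrixP => i j; rewrite mxE.
have := derive2_bk q (sa x) (delta_mx 0 i) (delta_mx 0 j) dv.
move=> /= ->; rewrite mulrA mulVf ?pnatr_eq0// mul1r.
by rewrite /bil trmx_delta -rowE -colE !mxE.
Qed.

(** In an induced chart [L] is [bk] of the chart components of [a] and [b], which are smooth in the
    base coordinates. *)
Lemma smooth_bk W : open W -> W `<=` regular -> tangent_smooth_on W L.
Proof.
move=> oW Wreg c ac k; have oU := (tangent_openP W).1 oW c ac.
have [sma _ _] := lor.
pose F pu : 'M[R]_n.+2 := chart_frame c pu.
have Usub : in_chart c W `<=` fst @^-1` chart_img c by move=> pu [].
have oC := @chart_img_open _ _ _ c.
have cfst : continuous (@fst 'rV[R]_n.+2 'rV[R]_n.+2) by move=> pu; exact: cvg_fst.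
have csnd : continuous (@snd 'rV[R]_n.+2 'rV[R]_n.+2) by move=> pu; exact: cvg_snd.
have cA := Ck_sub Usub (Ck_comp_linear oC cfst (sma c ac k)).
have cB := Ck_sub Usub (Ck_comp_linear oC cfst (ofb ac k)).
have cu := Ck_linear k (in_chart c W) csnd.
have quadE pu : bil (F pu.1 *m a (chart_inv c pu.1) *m (F pu.1)^T) pu.2 pu.2 =
    quad a (tangent_param c pu) by rewrite bil_congr.
have linE pu : dot (b (chart_inv c pu.1) *m (F pu.1)^T) pu.2 =
    lin b (tangent_param c pu).
  by rewrite /dot trmx_mul trmxK mulmxA.
have dom pu : in_chart c W pu -> bk_domain
    (F pu.1 *m a (chart_inv c pu.1) *m (F pu.1)^T)
    (b (chart_inv c pu.1) *m (F pu.1)^T) pu.2.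
  by move=> [_ /Wreg[A B]]; split; rewrite ?quadE ?linE.
have := Ck_bk q oU dom cA cB cu; apply: Ck_ext => // pu _.
by rewrite /bk quadE linE.
Qed.

Lemma bk_homogeneous x v (l : R) : 0 < l ->
  L (Tangent x (l *: v)) = l ^+ 2 * L (Tangent x v).
Proof.
move=> l0; rewrite /bk_function /ab_function /ab_ratio.
have -> : quad a (Tangent x (l *: v)) = l ^+ 2 * quad a (Tangent x v).
  by rewrite -[LHS]/(bil (a x) _ _) !bilE mulrA -expr2.
have -> : lin b (Tangent x (l *: v)) = l * lin b (Tangent x v).
  by rewrite -[LHS]/(dot (b x) _) dotZ.
by rewrite exprMn -mulf_div divff ?expf_neq0 ?gt_eqF// mul1r mulrA.
Qed.

Lemma open_lin_gt0 W : open W -> open (W `&` [set w | 0 < lin b w]).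
Proof.
move=> oW; apply/tangent_openP => c ac; have oU := (tangent_openP W).1 oW c ac.
have oC := @chart_img_open _ _ _ c.
have Usub : in_chart c W `<=` fst @^-1` chart_img c by move=> pu [].
have cfst : continuous (@fst 'rV[R]_n.+2 'rV[R]_n.+2) by move=> pu; exact: cvg_fst.
have csnd : continuous (@snd 'rV[R]_n.+2 'rV[R]_n.+2) by move=> pu; exact: cvg_snd.
have cB := Ck_sub Usub (Ck_comp_linear oC cfst (ofb ac 0)).
have cl := Ck_dot oU cB (Ck_linear 0 (in_chart c W) csnd).
have linE pu : dot (b (chart_inv c pu.1) *m (chart_frame c pu.1)^T) pu.2 =
    lin b (tangent_param c pu).
  by rewrite /dot trmx_mul trmxK mulmxA.
have := open_Ck_gt0 oU cl; congr (open _); apply/seteqP.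
split=> pu /=; first by move=> [[? ?]]; rewrite /= linE.
by move=> [? [? ?]]; rewrite /= linE.
Qed.

Section Time.
Variable Ta : set (tangent_bundle M).
Hypothesis toTa : time_orientation a Ta.

Lemma fiber_future x : exists2 t, 0 < bil (a x) t t & fiber Ta x = timecone (a x) t.
Proof.
have [_ /(_ x)[t tt ->]] := toTa; exists t => //.
exact: (timecone_component (sa x) (la x) tt).
Qed.

(** A fiber of [T] is connected, meets the future cone and has [A > 0], so [a(t, .)] keeps its
    positive sign on it. *)
Lemma cone_of_timelike_cones Q T x t : Q `<=` regular ->
  timelike_cones L Q Ta T -> 0 < bil (a x) t t -> fiber Ta x = timecone (a x) t ->
  [/\ open (fiber T x), fiber T x !=set0, fiber T x `<=` timecone (a x) t &
    forall v, fiber T x v -> bk_domain (a x) (b x) v /\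
      lorentzian_form (bk_tensor (a x) (b x) q v)].
Proof.
move=> Qreg [[[_ oT _ T0 _] _] TQ /(_ x)[cT _ lT _] /(_ x)[u [Tu Tau]]] tt fE.
move: Tau; rewrite fE => -[uu tu].
have dT v : fiber T x v -> bk_domain (a x) (b x) v by move=> /TQ/Qreg.
split => //; first exact: open_fiber.
- move=> v Tv; split; first by case: (dT v Tv).
  apply: (connected_gt0 cT (@continuous_bilr _ _ (a x) t) _ Tu) => // {}v {}Tv.
  have [vv _] := dT v Tv.
  apply: (lorentz_causal_neq0 (la x)) => //; first exact: ltW.
  by apply: contraTneq vv => ->; rewrite bil0l ltxx.
- move=> v Tv; split; first exact: dT.
  by rewrite -fundamental_tensor_bk; [exact: lT|exact: dT].
Qed.

Lemma timelike_cone_eq Q T x (C : set 'rV[R]_n.+2) : Q `<=` regular ->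
  timelike_cones L Q Ta T -> connected C -> C `<=` bk_domain (a x) (b x) ->
  fiber T x `<=` C -> fiber T x = C.
Proof.
move=> Qreg [[[_ oT _ T0 _] _] _ /(_ x)[_ _ _ ext] _] cC CD TC.
apply: (extends_by_0_eq (f := bk (a x) (b x) q) cC (open_fiber oT) (T0 x) TC _ _ ext).
  by move=> v; rewrite inE => /CD/bk_continuous; exact.
by move=> v /CD dv; apply/lt0r_neq0/(bk_gt0 q dv).
Qed.

Lemma timelike_cones_future Q W : connected [set: M] -> [set: M] !=set0 ->
  pseudo_finsler regular L Q -> open W -> W `<=` regular ->
  (forall x, fiber W x !=set0) -> (forall x, connected (fiber W x)) ->
  W `<=` Ta ->
  (forall x v (l : R), 0 < l -> W (Tangent x v) -> W (Tangent x (l *: v))) ->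
  (forall x v, W (Tangent x v) -> lorentzian_form (bk_tensor (a x) (b x) q v)) ->
  (forall x, extends_by_0 (fiber W x) (bk (a x) (b x) q)) ->
  timelike_cones L Q Ta W.
Proof.
move=> cM [x0 _] [_ maxQ] oW Wreg W0 cW WTa Wcone Wlor Wext.
have conicW : conic_subbundle W.
  split => //.
  - by have [v Wv] := W0 x0; exists (Tangent x0 v).
  - move=> [x v] /Wreg[A _] /=.
    by apply: contraTneq A => /= ->; rewrite bil0l ltxx.
have lorW x v : W (Tangent x v) -> lorentzian_form (fundamental_tensor L (Tangent x v)).
  by move=> Wv; rewrite fundamental_tensor_bk; [exact: Wlor|exact: Wreg].
split.
- by split => //; exact: connected_bundle.
- apply: maxQ; split => //; first exact: smooth_bk.
    by move=> x v l l0 _; exact: bk_homogeneous.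
  by move=> [x v] Wv; exact/lorentzian_form_unit/lorW.
- move=> x; split => //.
    by move=> v /Wreg dv; exact: (bk_gt0 q dv).
  by move=> v; exact: lorW.
- by move=> x; have [v Wv] := W0 x; exists v; split=> //; exact: WTa.
Qed.
End Time.
End BogoslovskyKropina.

(** * Conditions on [q] in a single tangent space *)

Section Pointwise.
Context {R : realType} {n : nat}.
Variables (a : 'M[R]_n.+2) (b : 'rV[R]_n.+2) (q : R).
Hypotheses (sa : a^T = a) (la : lorentzian_form a).
Implicit Types (t u v : 'rV[R]_n.+2).

Lemma bk_tensor_lorentzian_causal v : 0 <= conorm a b -> -1 <= q < 1 ->
  (q = -1 -> conorm a b != 0) -> bk_domain a b v ->
  lorentzian_form (bk_tensor a b q v).
Proof.
move=> c0 /andP[q1 ql1] qc dv; have [A B] := dv.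
apply: (bk_tensor_lorentzian sa la dv) => //.
have B2 : 0 < dot b v ^+ 2 by rewrite exprn_even_gt0.
have le := conorm_le b sa la A.
have [q0|q0] := leP 0 q.
  have -> : (1 + q) * dot b v ^+ 2 - q * conorm a b * bil a v v =
    dot b v ^+ 2 + q * (dot b v ^+ 2 - bil a v v * conorm a b) by ring.
  by rewrite ltr_pwDl// mulr_ge0// subr_ge0.
have {}q0 : 0 < - q by rewrite oppr_gt0.
rewrite -!mulNr; move: q1; rewrite le_eqVlt => /predU1P[q1|q1].
  rewrite -q1 subrr mul0r add0r opprK mul1r mulr_gt0//.
  by rewrite lt_neqAle eq_sym c0 qc.
rewrite ltr_pwDl//; first by rewrite mulr_gt0// -ltrBlDl sub0r.
by rewrite mulr_ge0 ?(ltW A)// mulr_ge0// ltW.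
Qed.

Lemma bk_tensor_lorentzian_spacelike v : conorm a b < 0 -> 0 < q < 1 ->
  bk_domain a b v -> lorentzian_form (bk_tensor a b q v).
Proof.
move=> c0 /andP[q0 q1] dv; have [A B] := dv.
apply: (bk_tensor_lorentzian sa la dv) => //.
rewrite -mulNr -mulrN ltr_pwDl//; first by rewrite mulr_gt0 ?addr_gt0// exprn_even_gt0.
by rewrite mulr_ge0 ?(ltW A)// mulr_ge0 ?oppr_ge0 ?(ltW q0) ?(ltW c0).
Qed.

Lemma bk_extends_causal t : 0 <= conorm a b -> b != 0 -> -1 <= q < 1 -> q != 0 ->
  (q = -1 -> conorm a b != 0) -> 0 < bil a t t ->
  extends_by_0 (timecone a t) (bk a b q).
Proof.
move=> c0 b0 /andP[q1 ql1] q0 qc tt.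
have [{}q0|q0'] := ltP 0 q.
  apply: bk_extends_pos => //; first by rewrite q0.
  - exact: open_timecone.
  - by move=> u [uu _]; split => //; exact: (causal_dot_neq0 sa la).
  - by move=> u clu nu; left; exact: (closure_timecone la tt clu nu).
have {q0'}q0 : q < 0 by rewrite lt_neqAle q0.
move: q1; rewrite le_eqVlt => /predU1P[q1|q1].
  by apply: bk_extends_kropina => //; rewrite lt_neqAle c0 eq_sym qc.
by apply: bk_extends_neg => //; rewrite q1.
Qed.

(** Only the sign of [s] matters; [s = 1] gives the chosen half and [s = b(v)] the half through a
    given [v]. *)
Definition half_cone t (s : R) := timecone a t `&` [set u | 0 < s * dot b u].

Lemma open_half_cone t s : open (half_cone t s).
Proof.
apply: openI; first exact: open_timecone.
by apply: open_gt0 => u; exact: (cvgM (cvg_cst s) (@continuous_dot _ _ b u)).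
Qed.

Lemma half_cone_domain t s : half_cone t s `<=` bk_domain a b.
Proof.
by move=> u [[uu _] /= su]; split => //; apply: contraTneq su => ->; rewrite mulr0 ltxx.
Qed.

Lemma half_cone_connected t s : 0 < bil a t t -> connected (half_cone t s).
Proof.
move=> tt; apply: convex_connected => u v k [Cu su] [Cv sv] k01.
split; first exact: timecone_convex.
have /andP[k0 k1] := k01; rewrite /= dotD dotZ -scaleN1r dotD dotZ.
have -> : s * (dot b u + k * (dot b v + -1 * dot b u)) =
  (1 - k) * (s * dot b u) + k * (s * dot b v) by ring.
move: k1; rewrite le_eqVlt => /predU1P[->|k1].
  by rewrite subrr mul0r add0r mul1r.
by apply: ltr_pwDl; [rewrite mulr_gt0 ?subr_gt0|rewrite mulr_ge0 ?(ltW sv)].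
Qed.

Lemma closure_half_cone t u : 0 < bil a t t -> closure (half_cone t 1) u ->
  ~ half_cone t 1 u -> bil a u u = 0 \/ dot b u = 0.
Proof.
move=> tt clu nu; have [Cu|nCu] := pselect (timecone a t u); last first.
  left; apply: (closure_timecone la tt _ nCu); apply: closure_subset clu.
  by move=> v [].
right; have Bu : 0 <= dot b u.
  have sub : half_cone t 1 `<=` [set u | 0 <= dot b u].
    by move=> v [_ /=]; rewrite mul1r => /ltW.
  have := closure_subset sub clu; rewrite -(closure_id _).1//.
  exact/closed_ge0/continuous_dot.
apply/eqP/negPn/negP => B0; apply: nu; split => //=.
by rewrite mul1r lt_neqAle eq_sym B0.
Qed.

Lemma half_cone_nonempty t s : conorm a b < 0 -> 0 < bil a t t -> s != 0 ->
  half_cone t s !=set0.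
Proof.
move=> c0 tt s0; have [u [Cu su _]] := spacelike_near_kernel sa la c0 tt ltr01 s0.
by exists u.
Qed.

Lemma causal_exponent_ge t : 0 <= conorm a b -> b != 0 -> 0 < bil a t t ->
  (forall u, timecone a t u -> lorentzian_form (bk_tensor a b q u)) -> -1 <= q.
Proof.
move=> c0 b0 tt lor; rewrite leNgt; apply/negP => q1.
have q1' : 0 < - q - 1 by lra.
(* If [q < -1], the Lorentzian condition reads [(-q - 1) B^2 < -q <b, b> A], which fails for [A]
   small against [B^2]; the summand [1] keeps the divisor positive when [<b, b> = 0]. *)
have kc : 0 < - q * conorm a b + 1 by rewrite ltr_pwDr// mulr_ge0//; lra.
have [u Cu uu] := near_null sa la c0 b0 tt (divr_gt0 q1' kc).
have B := causal_dot_neq0 sa la c0 b0 Cu.1.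
have B2 : 0 < dot b u ^+ 2 by rewrite exprn_even_gt0.
have := lorentzian_bk_tensor_gt0 sa la (conj Cu.1 B) (lor u Cu).
have := Cu.1; move: uu; rewrite mulrAC ltr_pdivlMr// => h A; nra.
Qed.

Lemma spacelike_exponent_gt t s : conorm a b < 0 -> 0 < bil a t t -> s != 0 -> q != 0 ->
  (forall u, half_cone t s u -> lorentzian_form (bk_tensor a b q u)) -> 0 < q.
Proof.
move=> c0 tt s0 q0 lor; rewrite ltNge le_eqVlt (negbTE q0) /=; apply/negP => q1.
have qc : 0 < q * conorm a b by rewrite nmulr_rgt0.
(* Here [B^2 < q <b, b> A], so the Lorentzian expression is less than [q B^2 <= 0]. *)
have [u [Cu su Bu]] := spacelike_near_kernel sa la c0 tt qc s0.
have Hu : half_cone t s u by [].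
have := lorentzian_bk_tensor_gt0 sa la (half_cone_domain Hu) (lor u Hu).
by have := sqr_ge0 (dot b u); nra.
Qed.
End Pointwise.

(** * The timelike cones of [L] on the manifold *)

Section Global.
Context {R : realType} {n : nat} (M : manifold R n.+2).
Variables (a : M -> 'M[R]_n.+2) (b : M -> 'rV[R]_n.+2) (q : R).
Variables (Ta Q : set (tangent_bundle M)).
Hypotheses (cM : connected [set: M]) (lor : lorentzian_metric a) (ofb : one_form b).
Hypotheses (toTa : time_orientation a Ta) (q0 : q != 0).
Hypothesis pfQ : pseudo_finsler (regular a b) (bk_function a b q) Q.
Implicit Types (x : M) (T : set (tangent_bundle M)).

Local Notation L := (bk_function a b q).

Let sa x : (a x)^T = a x. Proof. by case: lor. Qed.
Let la x : lorentzian_form (a x). Proof. by case: lor. Qed.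

Let Qreg : Q `<=` regular a b. Proof. by case: pfQ => -[[_ +] _ _ _]. Qed.

Let M0 : [set: M] !=set0.
Proof. by case: pfQ => -[[[[w _] _ _ _ _] _] _ _ _] _; exists (base w). Qed.

Let fiberQ x : fiber Q x !=set0. Proof. by case: pfQ => -[[[_ _ _ + _] _] _ _ _] _. Qed.

Lemma covector_neq0 x : b x != 0.
Proof.
have [v /Qreg[_ /=]] := fiberQ x; apply: contraNneq => ->.
by rewrite /dot trmx0 mulmx0 mxE.
Qed.

Lemma kropina_conorm_neq0 x : q = -1 -> conorm (a x) (b x) != 0.
Proof.
move=> q1; have [v Qv] := fiberQ x; apply/eqP => c0.
have := pfQ.1; case=> _ _ _ /(_ _ Qv).
rewrite (fundamental_tensor_bk q lor (Qreg Qv)) q1.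
by apply/negP; apply: (bk_tensor_degenerate (sa x) (la x)) => //; exact: Qreg Qv.
Qed.

Lemma timelike_cones_causal : (forall x, 0 <= sq_norm a b x) -> -1 <= q < 1 ->
  timelike_cones L Q Ta Ta.
Proof.
move=> c0 q1.
have dom : Ta `<=` regular a b.
  move=> [x v]; have [t tt fE] := fiber_future lor toTa x.
  rewrite -[Ta _]/(fiber Ta x v) fE => -[vv tv]; split => //.
  exact: (causal_dot_neq0 (sa x) (la x) (c0 x) (covector_neq0 x)).
apply: (timelike_cones_future lor ofb cM M0 pfQ toTa.1 dom) => //.
- by move=> x; have [t tt ->] := fiber_future lor toTa x; exists t.
- move=> x; have [t tt ->] := fiber_future lor toTa x.
  by apply: convex_connected => u v k *; exact: (timecone_convex (sa x) (la x)).
- move=> x v l l0; have [t tt fE] := fiber_future lor toTa x.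
  rewrite -![Ta _]/(fiber Ta x _) fE => -[vv tv].
  by split; rewrite !bilE ?mulr_gt0.
- move=> x v /dom dv.
  apply: (bk_tensor_lorentzian_causal (sa x) (la x) (c0 x) q1 _ dv).
  exact: kropina_conorm_neq0.
- move=> x; have [t tt ->] := fiber_future lor toTa x.
  apply: (bk_extends_causal (sa x) (la x) (c0 x) (covector_neq0 x) q1 q0 _ tt).
  exact: kropina_conorm_neq0.
Qed.

Lemma fiber_half x t : fiber Ta x = timecone (a x) t ->
  fiber (Ta `&` [set w | 0 < lin b w]) x = half_cone (a x) (b x) t 1.
Proof.
by move=> fE; rewrite /half_cone -fE; apply/seteqP;
  split=> v [Tv Bv]; split => //; move: Bv; rewrite /= mul1r.
Qed.

Lemma timelike_cones_spacelike : (forall x, sq_norm a b x < 0) -> 0 < q < 1 ->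
  timelike_cones L Q Ta (Ta `&` [set w | 0 < lin b w]).
Proof.
move=> c0 q1.
have dom : Ta `&` [set w | 0 < lin b w] `<=` regular a b.
  move=> [x v] Wv; have [t tt /fiber_half fE] := fiber_future lor toTa x.
  have : fiber (Ta `&` [set w | 0 < lin b w]) x v by [].
  by rewrite fE => /half_cone_domain.
apply: (timelike_cones_future lor ofb cM M0 pfQ (open_lin_gt0 ofb toTa.1) dom) => //.
- move=> x; have [t tt /fiber_half->] := fiber_future lor toTa x.
  exact: (half_cone_nonempty (sa x) (la x) (c0 x) tt (oner_neq0 _)).
- move=> x; have [t tt /fiber_half->] := fiber_future lor toTa x.
  by apply: half_cone_connected; [exact: sa|exact: la|exact: tt].
- move=> x v l l0 [Tv Bv]; split; last first.
    by move: Bv; rewrite /= -![lin b _]/(dot (b x) _) dotZ => Bv; rewrite mulr_gt0.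
  have [t tt fE] := fiber_future lor toTa x.
  move: Tv; rewrite -![Ta _]/(fiber Ta x _) fE => -[vv tv].
  by split; rewrite !bilE ?mulr_gt0.
- move=> x v /dom dv.
  exact: (bk_tensor_lorentzian_spacelike (sa x) (la x) (c0 x) q1 dv).
- move=> x; have [t tt /fiber_half->] := fiber_future lor toTa x.
  apply: bk_extends_pos => //; first exact: open_half_cone.
    exact: half_cone_domain.
  by move=> u; exact: (closure_half_cone (la x) tt).
Qed.

Lemma timelike_cones_exponent_lt1 T : timelike_cones L Q Ta T -> q < 1.
Proof.
move=> tcT; have [x _] := M0; have [t tt fE] := fiber_future lor toTa x.
have [_ [v Tv] _ /(_ v Tv)[dv lv]] := cone_of_timelike_cones lor Qreg tcT tt fE.
exact: (lorentzian_bk_tensor_lt1 (sa x) (la x) dv lv).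
Qed.

Lemma fiber_causal T x t : 0 <= sq_norm a b x -> timelike_cones L Q Ta T ->
  0 < bil (a x) t t -> fiber Ta x = timecone (a x) t ->
  fiber T x = timecone (a x) t.
Proof.
move=> c0 tcT tt fE.
have [_ _ TC _] := cone_of_timelike_cones lor Qreg tcT tt fE.
apply: (timelike_cone_eq Qreg tcT) => //.
  by apply: convex_connected => u v k *; exact: (timecone_convex (sa x) (la x)).
move=> v [vv tv]; split => //.
exact: (causal_dot_neq0 (sa x) (la x) c0 (covector_neq0 x)).
Qed.

Lemma fiber_spacelike T x t s : timelike_cones L Q Ta T ->
  0 < bil (a x) t t -> fiber Ta x = timecone (a x) t ->
  (forall v, fiber T x v -> 0 < s * dot (b x) v) ->
  fiber T x = half_cone (a x) (b x) t s.
Proof.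
move=> tcT tt fE Ts.
have [_ _ TC _] := cone_of_timelike_cones lor Qreg tcT tt fE.
apply: (timelike_cone_eq Qreg tcT).
- by apply: half_cone_connected; [exact: sa|exact: la|exact: tt].
- exact: half_cone_domain.
- by move=> v Tv; split; [exact: TC|exact: Ts].
Qed.

(** [B] has no zero on the connected fiber, so its sign is that at any one vector [v]. *)
Lemma fiber_spacelike_sign T x t : timelike_cones L Q Ta T ->
  0 < bil (a x) t t -> fiber Ta x = timecone (a x) t ->
  exists2 s, s != 0 & fiber T x = half_cone (a x) (b x) t s.
Proof.
move=> tcT tt fE.
have [_ [v Tv] TC dT] := cone_of_timelike_cones lor Qreg tcT tt fE.
have [[_ Bv] _] := dT v Tv; exists (dot (b x) v) => //.
apply: fiber_spacelike => //.
have [_ _ /(_ x)[cT _ _ _] _] := tcT.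
apply: (connected_gt0 cT (f := fun u => dot (b x) v * dot (b x) u) _ _ Tv).
- by move=> u; exact: (cvgM (cvg_cst _) (@continuous_dot _ _ (b x) u)).
- by move=> u /dT[[_ Bu] _]; rewrite mulf_neq0.
- by rewrite -expr2 exprn_even_gt0.
Qed.

Lemma fiber_ext T T' : (forall x, fiber T x = fiber T' x) -> T = T'.
Proof.
move=> fE; apply/seteqP; split => -[x v] Tv.
  by have : fiber T' x v by rewrite -fE.
by have : fiber T x v by rewrite fE.
Qed.

Lemma bogoslovsky_kropina_spacetime :
  (forall x, 0 <= sq_norm a b x) \/ (forall x, sq_norm a b x < 0) ->
  finsler_spacetime L Q Ta <->
  (forall x, 0 <= sq_norm a b x) /\ -1 <= q < 1 \/
  (forall x, sq_norm a b x < 0) /\ 0 < q < 1.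
Proof.
move=> hc; split; last first.
  case=> -[c0 q1]; first by exists Ta; exact: timelike_cones_causal.
  by exists (Ta `&` [set w | 0 < lin b w]); exact: timelike_cones_spacelike.
move=> [T tcT]; have q1 := timelike_cones_exponent_lt1 tcT; rewrite q1 andbT andbT.
(* One point decides: [q] is a constant and the causal character of [b] is the same everywhere. *)
have [x _] := M0; have [t tt fE] := fiber_future lor toTa x.
have [_ _ _ dT] := cone_of_timelike_cones lor Qreg tcT tt fE.
case: hc => c0; [left|right]; split => //.
  apply: (causal_exponent_ge (sa x) (la x) (c0 x) (covector_neq0 x) tt) => u.
  by rewrite -(fiber_causal (c0 x) tcT tt fE) => /dT[].
have [s s0 TE] := fiber_spacelike_sign tcT tt fE.
apply: (spacelike_exponent_gt (sa x) (la x) (c0 x) tt s0 q0) => u.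
by rewrite -TE => /dT[].
Qed.
End Global.

(** The equivalences with [T = ...] assert both that the stated set is a system of timelike cones
    and that it is the only one, in (ii) among those with [B > 0]. *)
Theorem proposition8 (R : realType) (M : manifold R 4)
    (a : M -> 'M[R]_4) (b : M -> 'rV[R]_4)
    (Ta : set (tangent_bundle M)) (q : R) (Q : set (tangent_bundle M)) :
  connected [set: M] ->
  orientable M ->
  lorentzian_metric a ->
  one_form b ->
  time_orientation a Ta ->
  (forall x, 0 <= sq_norm a b x) \/ (forall x, sq_norm a b x < 0) ->
  q != 0 ->
  bogoslovsky_kropina a b q Q ->
  let L := bk_function a b q in
  let case_i := (forall x, 0 <= sq_norm a b x) /\ -1 <= q < 1 in
  let case_ii := (forall x, sq_norm a b x < 0) /\ 0 < q < 1 in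
  [/\ finsler_spacetime L Q Ta <-> case_i \/ case_ii,
      case_i -> forall T, timelike_cones L Q Ta T <-> T = Ta
    & case_ii -> forall T,
        (timelike_cones L Q Ta T /\ (forall w, T w -> 0 < lin b w)) <->
        T = Ta `&` [set w | 0 < lin b w]].
Proof.
move=> cM _ lor ofb toTa hc q0 [pfQ _] L case_i case_ii.
rewrite regularE in pfQ; split.
- exact: (bogoslovsky_kropina_spacetime cM lor ofb toTa q0 pfQ hc).
- move=> [c0 q1] T; split => [tcT|->]; last first.
    exact: (timelike_cones_causal cM lor ofb toTa q0 pfQ c0 q1).
  apply: fiber_ext => x; have [t tt fE] := fiber_future lor toTa x.
  by rewrite fE; exact: (fiber_causal lor pfQ (c0 x) tcT tt fE).
- move=> [c0 q1] T; split => [[tcT BT]|->]; last first.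
    split; last by move=> w [].
    exact: (timelike_cones_spacelike cM lor ofb toTa pfQ c0 q1).
  apply: fiber_ext => x; have [t tt fE] := fiber_future lor toTa x.
  rewrite (fiber_half b fE); apply: (fiber_spacelike lor pfQ tcT tt fE).
  by move=> v /BT; rewrite mul1r.
Qed.
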